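(* Let $z_1,z_2,z_3$ be indeterminates. For every integer $n\ge 3$, the triply-refined ASM generating function at $x=y=1$ satisfies $$\begin{aligned} &(z_1z_3-z_3+1)(z_2z_3-z_2+1)\,z_3^{n-1}\,Z^{\mathrm{tri}}_n(1,1;z_1,z_2,\tfrac{1}{z_3})=\\ &\frac{z_1z_3}{\mathcal{A}_{n-2}\,(z_1-z_2)(z_3-1)}\Bigl((z_1z_3-z_1+1)(z_1z_3-z_3+1)\,z_2\,Z_{n-1}(1,1;z_1)\,Z^{\mathrm{opp}}_{n-1}(1,1;z_2,z_3)\\ &\qquad\qquad-(z_2z_3-z_2+1)(z_2z_3-z_3+1)\,z_1\,Z_{n-1}(1,1;z_2)\,Z^{\mathrm{opp}}_{n-1}(1,1;z_1,z_3)\Bigr)\\ &+(z_2-1)(z_3-1)(z_1z_3-z_3+1)\,z_1z_2^{n-1}\,Z_{n-1}(1,1;z_1)\\ &+(z_1-1)(z_3-1)(z_2z_3-z_2+1)\,z_3^{n-1}\,Z_{n-1}(1,1;z_2). \end{aligned}$$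
   Context: An alternating sign matrix (ASM) is a square matrix with entries in $\{0,1,-1\}$ such that along each row and each column the nonzero entries alternate in sign and sum to $1$. $\mathrm{ASM}(n)$ is the set of $n\times n$ ASMs, and $\mathcal{A}_n=|\mathrm{ASM}(n)|$. The first and last rows and columns of an ASM each contain exactly one $1$, all other entries there being $0$. For $A\in\mathrm{ASM}(n)$ define: $\rho_{\mathrm T}(A)=$ number of $0$'s to the left of the $1$ in the top row; $\rho_{\mathrm B}(A)=$ number of $0$'s to the right of the $1$ in the bottom row; $\rho_{\mathrm L}(A)=$ number of $0$'s above the $1$ in the left-most column. Generating functions with both bulk parameters equal to $1$ (for $n\ge1$): $Z^{\mathrm{tri}}_n(1,1;z_1,z_2,z_3)=\sum_{A\in\mathrm{ASM}(n)}z_1^{\rho_{\mathrm T}(A)}z_2^{\rho_{\mathrm B}(A)}z_3^{\rho_{\mathrm L}(A)}$; $Z^{\mathrm{opp}}_n(1,1;z_1,z_2)=\sum_{A\in\mathrm{ASM}(n)}z_1^{\rho_{\mathrm T}(A)}z_2^{\rho_{\mathrm B}(A)}$; $Z_n(1,1;z)=\sum_{A\in\mathrm{ASM}(n)}z^{\rho_{\mathrm T}(A)}$. *)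

(* Defs.v *)
From mathcomp Require Export all_boot all_order all_algebra.
From mathcomp Require Export fraction mpoly.
Set Implicit Arguments.
Unset Strict Implicit.
Unset Printing Implicit Defensive.

Import Order.TTheory GRing.Theory Num.Theory.

Local Open Scope ring_scope.

(* The set {0, 1, -1} as a finite type, so that 'M[asm_entry]_n is finite. *)
Notation asm_entry := (seq_sub [:: 0; 1; -1 : int]).

Definition asm_int n (A : 'M[asm_entry]_n) : 'M[int]_n := map_mx val A.

Definition asm_line (s : seq int) : bool :=
  let t := [seq x <- s | x != 0] in
  sorted (fun x y => x * y < 0) t && (\sum_(x <- t) x == 1).

Definition is_asm n (A : 'M[int]_n) : bool :=
  [forall i, asm_line [seq A i j | j <- enum 'I_n]] &&
  [forall j, asm_line [seq A i j | i <- enum 'I_n]].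

Definition ASM n : {set 'M[asm_entry]_n} := [set A | is_asm (asm_int A)].

(* The top row and left-most column have index 0, the bottom row index n - 1. *)
Definition rho_T n (A : 'M[int]_n) : nat :=
  #|[set j : 'I_n | [exists i : 'I_n, exists k : 'I_n,
      [&& i == 0%N :> nat, A i j == 0, A i k == 1 & (j < k)%N]]]|.

Definition rho_B n (A : 'M[int]_n) : nat :=
  #|[set j : 'I_n | [exists i : 'I_n, exists k : 'I_n,
      [&& i.+1 == n :> nat, A i j == 0, A i k == 1 & (k < j)%N]]]|.

Definition rho_L n (A : 'M[int]_n) : nat :=
  #|[set i : 'I_n | [exists j : 'I_n, exists k : 'I_n,
      [&& j == 0%N :> nat, A i j == 0, A k j == 1 & (i < k)%N]]]|.

(* Both bulk parameters are set to 1 in the three generating functions. *)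
Definition Z_tri (F : fieldType) n (z1 z2 z3 : F) : F :=
  \sum_(A in ASM n) z1 ^+ rho_T (asm_int A) * z2 ^+ rho_B (asm_int A)
                    * z3 ^+ rho_L (asm_int A).

Definition Z_opp (F : fieldType) n (z1 z2 : F) : F :=
  \sum_(A in ASM n) z1 ^+ rho_T (asm_int A) * z2 ^+ rho_B (asm_int A).

Definition Z (F : fieldType) n (z : F) : F :=
  \sum_(A in ASM n) z ^+ rho_T (asm_int A).

(* The field Q(z1, z2, z3), with its indeterminates indexed by 0, 1, 2. *)
Notation ratfun3 := {fraction {mpoly rat[3]}}.

Definition indet (i : 'I_3) : ratfun3 := tofrac ('X_i : {mpoly rat[3]}).

(* Main.v *)
(** The edges of a domain-wall six-vertex lattice carry the partial sums of the
    rows and columns of an ASM.  With row parameters u and column parameters v,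
    give a zero entry the weight uv - u + 1 or uv - v + 1, an entry 1 the weight
    1 and an entry -1 the weight (u^2 - u + 1)(v^2 - v + 1).  These are rational
    coordinates for the combinatorial point of the model: all weights are 1 at
    u = v = 1, and a boundary line with parameter z contributes z^rho when the
    parameters crossing it are 1.  By the Yang-Baxter equation the partition
    function is symmetric in the rows and in the columns; it has degree at most
    n - 1 in each parameter, and it factorizes when a corner weight vanishes.
    Interpolation at the zeros of the corner weights gives, by induction on n,
    its symmetry in all 2n parameters, and then a chain of bilinear relations
    ending with the Desnanot-Jacobi identity for the Izergin-Korepin determinant
    (the determinant itself is not needed).  The theorem is this identity at
    (z1, z2, z3, 1, ..., 1), corrected for the ASMs with a 1 in a left corner. *)

Require Import Defs.
From mathcomp Require Import zify ring.
Set Implicit Arguments.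
Unset Strict Implicit.
Unset Printing Implicit Defensive.
Import GRing.Theory.
Local Open Scope ring_scope.

(** * The six-vertex model *)

(* The edges to the left of and above entry (i, j) carry the partial sums l and
   s of its row and column; a zero entry weighs [straight (d (+) (l == s))].
   The theorem concerns d = true, and d = false is the transposed model. *)
Definition straight (R : comNzRingType) (d : bool) (u v : R) : R :=
  if d then u * v - u + 1 else u * v - v + 1.

Definition turn (R : comNzRingType) (u : R) : R := u ^+ 2 - u + 1.

(* One row with left edge l, right edge r and top edges s, where f weighs the
   part of the lattice below it as a function of the bottom edges. *)
Fixpoint transfer (R : comNzRingType) (d : bool) (u : R) (vs : seq R)
    (l r : bool) (f : seq bool -> R) (s : seq bool) : R :=
  match vs, s with
  | v :: vs', x :: s' =>
      straight (d (+) (l == x)) u v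
        * transfer d u vs' l r (fun t => f (x :: t)) s'
      + (l == x)%:R * (if l then turn u * turn v else 1)
        * transfer d u vs' (~~ l) r (fun t => f (~~ x :: t)) s'
  | _, _ => (l == r)%:R * f [::]
  end.

(** The final test on the bottom edges asks every column sum to be 1, as the right edge [true] does
    for every row sum. *)
Fixpoint domain_wall (R : comNzRingType) (d : bool) (us vs : seq R)
    (s : seq bool) : R :=
  if us is u :: us' then transfer d u vs false true (domain_wall d us' vs) s
  else (all id s)%:R.

Definition dwbc (R : comNzRingType) (d : bool) (us vs : seq R) : R :=
  domain_wall d us vs (nseq (size vs) false).

Section Transfer.
Variable R : comNzRingType.
Implicit Types (u v : R) (us vs : seq R) (f g : seq bool -> R) (s : seq bool).

Lemma eq_transfer d u vs l r f g s : size s = size vs ->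
  (forall t, size t = size vs -> f t = g t) ->
  transfer d u vs l r f s = transfer d u vs l r g s.
Proof.
elim: vs l f g s => [|v vs IH] l f g [|x s] //= => [_ ->//|[szs] fg].
by congr (_ * _ + _ * _); apply: IH => // t szt; apply: fg; rewrite /= szt.
Qed.

Lemma transferD d u vs l r f g (a b : R) s :
  transfer d u vs l r (fun t => a * f t + b * g t) s
  = a * transfer d u vs l r f s + b * transfer d u vs l r g s.
Proof.
elim: vs l f g s => [|v vs IH] l f g [|x s] /=; try ring.
by rewrite !(IH _ (fun t => f (_ :: t)) (fun t => g (_ :: t))); ring.
Qed.

Let two d u1 u2 vs l1 l2 f s :=
  transfer d u1 vs l1 true (transfer d u2 vs l2 true f) s.

Let two_nil d u1 u2 l1 l2 f s :
  two d u1 u2 [::] l1 l2 f s = (l1 && l2)%:R * f [::].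
Proof. by rewrite /two /= !eqb_id mulrA -natrM mulnb. Qed.

Let two_cons d u1 u2 v vs l1 l2 f x s :
  two d u1 u2 (v :: vs) l1 l2 f (x :: s) =
  straight (d (+) (l1 == x)) u1 v *
    (straight (d (+) (l2 == x)) u2 v
       * two d u1 u2 vs l1 l2 (fun t => f (x :: t)) s
     + (l2 == x)%:R * (if l2 then turn u2 * turn v else 1)
       * two d u1 u2 vs l1 (~~ l2) (fun t => f (~~ x :: t)) s)
  + (l1 == x)%:R * (if l1 then turn u1 * turn v else 1) *
    (straight (d (+) (l2 == ~~ x)) u2 v
       * two d u1 u2 vs (~~ l1) l2 (fun t => f (~~ x :: t)) s
     + (l2 == ~~ x)%:R * (if l2 then turn u2 * turn v else 1)
       * two d u1 u2 vs (~~ l1) (~~ l2) (fun t => f (~~ ~~ x :: t)) s).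
Proof. by rewrite /two /= !transferD. Qed.

(* The Yang-Baxter equation, passed through the columns from left to right. *)
Lemma transfer_braid d u1 u2 vs f s : size s = size vs ->
  let al := straight (~~ d) u1 u2 in
  let ga := (-1) ^+ d * (u2 - u1) in
  let D := two d u1 u2 vs in let D' := two d u2 u1 vs in
  [/\ al * D false false f s = al * D' false false f s,
      al * D true true f s = al * D' true true f s,
      turn u1 * D false true f s + ga * D true false f s
        = al * D' false true f s &
      turn u2 * D true false f s + ga * D false true f s
        = al * D' true false f s].
Proof.
move=> szs al ga D D'; rewrite {}/D {}/D'.
elim: vs f s szs => [|v vs IH] f [|x s] //= szs.
  by rewrite !two_nil; split; rewrite ?mul0r ?mulr0 ?addr0.
case: szs => szs.
have [E1 E2 E3 E4] := IH (fun t => f (false :: t)) s szs.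
have [F1 F2 F3 F4] := IH (fun t => f (true :: t)) s szs.
(* This carries the crossing weight [al] next to each shorter double row, where the induction
   hypotheses apply. What remains for each choice of edges is a polynomial identity. *)
have dist (a A B C A' B' C' y1 y2 y3 y4 : R) :
    a * (A * (B * y1 + C * y2) + A' * (B' * y3 + C' * y4))
    = A * (B * (a * y1) + C * (a * y2)) + A' * (B' * (a * y3) + C' * (a * y4)).
  by ring.
rewrite !two_cons -/al -/ga in E1 E2 E3 E4 F1 F2 F3 F4 *.
by case: x {IH}; split; rewrite [RHS]dist /= -?(E1, E2, E3, E4, F1, F2, F3, F4)
  /al /ga /straight /turn; case: d {al ga E1 E2 E3 E4 F1 F2 F3 F4} => /=; ring.
Qed.

(** With both left edges 0 the Yang-Baxter equation is scalar. The crossing weight stays on both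
    sides because it may vanish or be a zero divisor. *)
Lemma transferC u1 u2 d vs f s : size s = size vs ->
  straight (~~ d) u1 u2
    * transfer d u1 vs false true (transfer d u2 vs false true f) s
  = straight (~~ d) u1 u2
    * transfer d u2 vs false true (transfer d u1 vs false true f) s.
Proof. by move=> /(transfer_braid d u1 u2 f)[]. Qed.

End Transfer.

(** * Alternating sign matrices as states of the model *)

Definition flip (s : bool) : int := if s then -1 else 1.

(** An automaton for the lines of an ASM, with the partial sum as its state: a nonzero entry must
    move this sum between 0 and 1, and the last sum must be 1. *)
Fixpoint run (s : bool) (x : seq int) : bool :=
  if x is a :: x' then
    if a == 0 then run s x' else (a == flip s) && run (~~ s) x'
  else s.

(* On a line of an ASM, [state false x j] is the sum of the first j entries. *)
Definition state (s : bool) (x : seq int) (j : nat) : bool :=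
  s (+) odd (count (predC1 0) (take j x)).

(** Alternation leaves the sign of the first nonzero entry open. The sum 1 decides it, because an
    alternating sequence of entries 1 and -1 that starts with -1 has a sum at most 0. *)
Lemma asm_line_run (x : seq int) : all (mem [:: 0; 1; -1 : int]) x ->
  asm_line x = run false x.
Proof.
move=> x01; rewrite /asm_line; set t := [seq a <- x | _].
(* An imaginary entry [- flip s] in front of the line forces the first nonzero entry to be
   [flip s]. *)
have alt s : run s x = path (fun a b => a * b < 0) (- flip s) t
                       && (\sum_(a <- t) a == (~~ s)%:R).
  rewrite {}/t; elim: x x01 s => [|a x IH] /= x01 s.
    by rewrite big_nil; case: s.
  case/andP: x01 => ha /IH {}IH.
  case: eqP => [->|] //= a0.
  rewrite !big_cons IH.
  move: ha a0; rewrite !inE => /or3P[] /eqP -> // _; case: s => //=.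
  - by congr (_ && _); apply/eqP/eqP; lia.
  - by congr (_ && _); apply/eqP/eqP; lia.
rewrite alt.
have t0 : all (fun a => (a == 1) || (a == -1)) t.
  rewrite /t all_filter; apply: sub_all x01 => a /=; rewrite !inE.
  by case: eqP.
case: t t0 {alt} => [|a t] //= /andP[/orP[]/eqP-> t0] //=.
apply/negbTE; rewrite negb_and.
rewrite orbC -implybE; apply/implyP => /eqP sum1.
apply/negP => pt.
have: \sum_(a <- -1 :: t) a <= 0.
  (* The leading entries -1 and 1 cancel, so the induction removes them in pairs. *)
  elim/ltn_ind: {t}(size t) {-2}t (erefl (size t)) t0 pt {sum1} =>
    m IH [|b [|c t]] //=.
  - by rewrite big_cons big_nil.
  - by move=> _ /andP[/orP[]/eqP-> _] //=; rewrite !big_cons big_nil.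
  move=> szt /and3P[/orP[]/eqP-> // /orP[]/eqP-> // t0] /and3P[_ _ pt].
  rewrite !big_cons; have := IH (size t) _ t erefl t0 pt;
    rewrite big_cons -szt addrCA addNKr; apply; lia.
by rewrite sum1.
Qed.

Lemma state_cons s a x j : state s (a :: x) j.+1 = state (s (+) (a != 0)) x j.
Proof. by rewrite /state /= oddD addbA oddb. Qed.

Lemma run_state s x j : (j < size x)%N -> run s x -> nth 0 x j != 0 ->
  nth 0 x j = flip (state s x j).
Proof.
elim: x s j => [|a x IH] s [|j] //= jx.
  by case: eqP => // _ /andP[/eqP-> _] _; rewrite /state addbF.
rewrite state_cons; case: eqP => [_|_ /andP[_]] r xj.
  by rewrite addbF (IH _ _ jx r xj).
by rewrite addbT (IH _ _ jx r xj).
Qed.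

(** For nonzero [a] the weight is read off [l]: a nonzero entry of an ASM is -1 exactly when the
    partial sum before it is 1. *)
Definition vertex (R : comNzRingType) (d : bool) (u v : R) (a : int)
    (l s : bool) : R :=
  if a == 0 then straight (d (+) (l == s)) u v
  else if l then turn u * turn v else 1.

(** * Expansion of the partition function over matrices *)

Section States.
Variable R : comNzRingType.
Implicit Types (u v : R) (us vs : seq R) (s : seq bool) (x : seq int).

Definition update s x := [seq p.1 (+) (p.2 != 0) | p <- zip s x].

Definition allowed (s : bool) (a : int) := (a == 0) || (a == flip s).

Fixpoint row_weight d u vs (l : bool) s x : R :=
  match vs, s, x with
  | v :: vs', b :: s', a :: x' =>
      if a == 0 then straight (d (+) (l == b)) u v * row_weight d u vs' l s' x'
      else ((l == b) && (a == flip l))%:R * (if l then turn u * turn v else 1)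
           * row_weight d u vs' (~~ l) s' x'
  | _, _, _ => l%:R
  end.

Fixpoint weight d us vs s (X : seq (seq int)) : R :=
  match us, X with
  | u :: us', x :: X' =>
      row_weight d u vs false s x * weight d us' vs (update s x) X'
  | _, _ => (all id s)%:R
  end.

Lemma row_weightE d u vs l s x : size s = size vs -> size x = size vs ->
  row_weight d u vs l s x
  = (run l x && all (fun p => allowed p.1 p.2) (zip s x))%:R
    * \prod_(j < size vs)
        vertex d u vs`_j (nth 0 x j) (state l x j) (nth false s j).
Proof.
elim: vs l s x => [|v vs IH] l [|b s] [|a x] //=.
  by rewrite big_ord0 andbT mulr1.
case=> szs [szx]; rewrite big_ord_recl /= !IH //.
under eq_bigr do rewrite !add0n state_cons.
have -> : state l (a :: x) 0 = l by rewrite /state addbF.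
set P := \prod_(i < _) _; rewrite /vertex /allowed.
move: @P; case: (eqVneq a 0) => [->|a0] /=.
  by rewrite addbF mulrCA.
rewrite addbT; case: (eqVneq l b) => [<-|lb] /=.
  by case: (a == flip l); rewrite ?mul0r //= mul1r mulrCA.
case: eqP => [->|_] /=; last by rewrite !mul0r.
by rewrite (_ : _ == _ = false) ?andbF ?mul0r //; case: l b lb {a0} => [] [].
Qed.

Lemma size_update s x : size x = size s -> size (update s x) = size s.
Proof. by move=> szx; rewrite size_map size_zip szx minnn. Qed.

Lemma nth_update s x j : (j < size s)%N -> size x = size s ->
  nth false (update s x) j = nth false s j (+) (nth 0 x j != 0).
Proof.
move=> js szx; rewrite (nth_map (false, 0)) ?size_zip ?szx ?minnn //.
by rewrite nth_zip.
Qed.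

Definition column (X : seq (seq int)) j := [seq nth 0 x j | x <- X].

Definition valid s n X :=
  all (run false) X && [forall j : 'I_n, run (nth false s j) (column X j)].

Lemma weightE d us vs s X : size s = size vs -> size X = size us ->
  all (fun x => size x == size vs) X ->
  weight d us vs s X
  = (valid s (size vs) X)%:R
    * \prod_(i < size us) \prod_(j < size vs)
        vertex d us`_i vs`_j (nth 0 (nth [::] X i) j)
          (state false (nth [::] X i) j) (state (nth false s j) (column X j) i).
Proof.
move=> szs; elim: us s X szs => [|u us IH] s [|x X] //= szs.
  rewrite big_ord0 mulr1 => _ _; congr (nat_of_bool _)%:R; rewrite /valid /=.
  apply/idP/forallP => [/all_nthP sj j|sj]; first by apply: sj; rewrite szs.
  apply/(all_nthP false) => j; rewrite szs => js; exact: (sj (Ordinal js)).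
move=> [szX] /andP[/eqP szx szXv].
have szxs : size x = size s by rewrite szx szs.
rewrite row_weightE // IH ?size_update // big_ord_recl /=.
have -> : \prod_(j < size vs) vertex d u vs`_j x`_j (state false x j)
   (state (nth false s j) (column (x :: X) j) 0) =
   \prod_(j < size vs) vertex d u vs`_j x`_j (state false x j) (nth false s j).
  by apply: eq_bigr => j _; rewrite [state _ (column _ _) _]/state addbF.
rewrite mulrACA -natrM mulnb; congr (_%:R * (_ * _)); last first.
  apply: eq_bigr => i _; apply: eq_bigr => j _.
  by rewrite !add0n /= state_cons nth_update // szs.
rewrite /valid /= -!andbA; congr (_ && _); rewrite andbCA; congr (_ && _).

(* Each column condition splits into the one on its first entry and the one on the rest, which is
   read from the updated edge. *)
apply/andP/forallP => [[/(all_nthP (false, 0))sx r] j|r].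
  have jx : (j < size s)%N by rewrite szs.
  have := sx j; rewrite size_zip szxs minnn nth_zip // => /(_ jx) /=.
  have := forallP r j; rewrite nth_update // /allowed.
  by case: eqP => _ /=; rewrite ?addbF ?addbT // => -> ->.
split.
  apply/(all_nthP (false, 0)) => j; rewrite size_zip szxs minnn => js.
  rewrite szs in js; have := r (Ordinal js); rewrite nth_zip //= /allowed.
  by case: eqP => //= _ /andP[].
apply/forallP => j; have := r j; rewrite nth_update ?szs //.
by case: eqP => _; rewrite ?addbF // addbT => /andP[].
Qed.

Lemma big_entry (F : int -> R) :
  \sum_(a : asm_entry) F (val a) = F 0 + F 1 + F (-1).
Proof.
rewrite -(big_map _ xpredT F) /=.
rewrite (perm_big [:: 0; 1; -1]) /= ?big_cons ?big_nil ?addr0 ?addrA //.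
apply: uniq_perm => //.
  by rewrite map_inj_uniq ?index_enum_uniq //; apply: val_inj.
move=> a; apply/mapP/idP => [[b _ ->]|ha]; first exact: ssvalP.
by exists (SeqSub ha); rewrite ?mem_index_enum.
Qed.

Lemma big_tupleS (T : finType) n (F : n.+1.-tuple T -> R) :
  \sum_t F t = \sum_x \sum_(t : n.-tuple T) F [tuple of x :: t].
Proof.
rewrite pair_bigA (reindex (fun p : T * n.-tuple T =>
  [tuple of p.1 :: p.2])) //.
exists (fun t => (thead t, [tuple of behead t])) => [[x t] _|t _] /=.
  by congr pair; apply: val_inj.
by apply: val_inj; rewrite /= [t in RHS]tuple_eta.
Qed.

Lemma transfer_sum n d u vs (l : bool) f s : size vs = n -> size s = n ->
  transfer d u vs l true f s
  = \sum_(x : n.-tuple asm_entry)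
      row_weight d u vs l s (map val x) * f (update s (map val x)).
Proof.
elim: n vs l f s => [|n IH] [|v vs] l f [|b s] //=.
  rewrite (big_pred1 [tuple]) => [|t]; first by rewrite eqb_id.
  by apply/esym/eqP; rewrite tuple0.
move=> [szv] [szs]; rewrite big_tupleS.
under eq_bigr => a _.
  under eq_bigr => x _ do rewrite /=.
  over.
set G := fun a : int => \sum_(x : n.-tuple asm_entry)
   row_weight d u (v :: vs) l (b :: s) (a :: map val x)
   * f (update (b :: s) (a :: map val x)).
rewrite [RHS](big_entry G) /G !IH //= !mulr_sumr -!big_split /=.
apply: eq_bigr => x _; rewrite [update (_ :: _) (0 :: _)]/update [update (_ ::
  _) (1 :: _)]/update [update (_ :: _) (-1 :: _)]/update /= -/(update s _)
  addbF !addbT.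
case: l {G} => /=; case: b; rewrite /= ?mulr0 ?mul0r ?mulr1 ?mul1r ?addr0
  ?mulrA //.
Qed.

Definition mat_seq k n (X : k.-tuple (n.-tuple asm_entry)) : seq (seq int) :=
  [seq map val (x : seq _) | x : n.-tuple asm_entry <- X].

Lemma domain_wall_sum k n d us vs s : size us = k -> size vs = n ->
  size s = n ->
  domain_wall d us vs s
  = \sum_(X : k.-tuple (n.-tuple asm_entry)) weight d us vs s (mat_seq X).
Proof.
move=> szu szv; elim: k us szu s => [|k IH] [|u us] //= szu s szs.
  rewrite (big_pred1 [tuple]) // => t; by apply/esym/eqP; rewrite tuple0.
case: szu => szu; rewrite big_tupleS (transfer_sum _ _ _ _ szv szs).
apply: eq_bigr => x _; rewrite IH ?size_update ?size_map ?size_tuple //.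
by rewrite mulr_sumr.
Qed.
End States.

Definition h_state n (A : 'M[int]_n) (i j : 'I_n) : bool :=
  state false [seq A i k | k <- enum 'I_n] j.

Definition v_state n (A : 'M[int]_n) (i j : 'I_n) : bool :=
  state false [seq A k j | k <- enum 'I_n] i.

Lemma entry_mem n (A : 'M[asm_entry]_n) i j :
  asm_int A i j \in [:: 0; 1; -1 : int].
Proof. by rewrite mxE; apply: ssvalP. Qed.

Lemma is_asm_run n (A : 'M[asm_entry]_n) : is_asm (asm_int A) =
  [forall i, run false [seq asm_int A i j | j <- enum 'I_n]]
  && [forall j, run false [seq asm_int A i j | i <- enum 'I_n]].
Proof.
congr (_ && _); apply: eq_forallb => i; apply: asm_line_run;
  by apply/allP => _ /mapP[j _ ->]; apply: entry_mem.
Qed.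

Lemma nth_map_enum (T : Type) (x0 : T) n (f : 'I_n -> T) (i : 'I_n) :
  nth x0 [seq f j | j <- enum 'I_n] i = f i.
Proof. by rewrite (nth_map i) ?size_enum_ord // nth_ord_enum. Qed.

(** The recursion sums over all matrices with entries 0, 1 and -1. A weight vanishes unless [run]
    accepts every row and column, so only the ASMs remain. *)
Lemma dwbc_sum (R : comNzRingType) n d (us vs : seq R) :
  size us = n -> size vs = n ->
  dwbc d us vs = \sum_(A in ASM n) \prod_(i < n) \prod_(j < n)
    vertex d us`_i vs`_j (asm_int A i j) (h_state (asm_int A) i j)
      (v_state (asm_int A) i j).
Proof.
move=> szu szv; rewrite /dwbc szv.
rewrite (domain_wall_sum d szu szv (size_nseq _ _)).
pose tup (A : 'M[asm_entry]_n) := [tuple [tuple A i j | j < n] | i < n].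
rewrite (reindex tup) /=; last first.
  exists (fun X : n.-tuple (n.-tuple asm_entry) =>
    \matrix_(i, j) tnth (tnth X i) j).
    by move=> A _; apply/matrixP => i j; rewrite !mxE !tnth_mktuple.
  move=> X _; apply: eq_from_tnth => i; apply: eq_from_tnth => j.
  by rewrite !tnth_mktuple mxE.
rewrite [RHS]big_mkcond /=; apply: eq_bigr => A _.
have -> : mat_seq (tup A)
    = [seq [seq asm_int A i j | j <- enum 'I_n] | i <- enum 'I_n].
  rewrite /mat_seq /= -map_comp; apply: eq_map => i /=.
  by rewrite -map_comp; apply: eq_map => j /=; rewrite mxE.
rewrite weightE ?szu ?szv ?size_nseq ?size_map -?enumT ?size_enum_ord //;
  last by apply/allP => _ /mapP[i _ ->]; rewrite size_map size_enum_ord.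
rewrite inE is_asm_run.
have colE (j : 'I_n) :
    column [seq [seq asm_int A i j | j <- enum 'I_n] | i <- enum 'I_n] j
    = [seq asm_int A i j | i <- enum 'I_n].
  by rewrite /column -map_comp; apply: eq_map => i /=; rewrite nth_map_enum.
have -> : valid (nseq n false) n
   [seq [seq asm_int A i j | j <- enum 'I_n] | i <- enum 'I_n]
  = [forall i, run false [seq asm_int A i j | j <- enum 'I_n]]
  && [forall j, run false [seq asm_int A i j | i <- enum 'I_n]].
  congr (_ && _); last by apply: eq_forallb => j; rewrite nth_nseq ltn_ord colE.
  rewrite all_map; apply/allP/forallP => r i; first by apply: r;
    rewrite mem_enum.
  by move=> _; apply: r.
case: ifP => _; rewrite ?mul0r // mul1r.
apply: eq_bigr => i _; apply: eq_bigr => j _.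
by rewrite colE nth_nseq ltn_ord !nth_map_enum.
Qed.

Lemma asm_rowP n (A : 'M[asm_entry]_n) i : A \in ASM n ->
  run false [seq asm_int A i j | j <- enum 'I_n].
Proof. by rewrite inE is_asm_run => /andP[/forallP]. Qed.

Lemma asm_colP n (A : 'M[asm_entry]_n) j : A \in ASM n ->
  run false [seq asm_int A i j | i <- enum 'I_n].
Proof. by rewrite inE is_asm_run => /andP[_ /forallP]. Qed.

Lemma asm_h_state n (A : 'M[asm_entry]_n) i j : A \in ASM n ->
  asm_int A i j != 0 -> asm_int A i j = flip (h_state (asm_int A) i j).
Proof.
move=> /(asm_rowP i)/run_state - /(_ j).
by rewrite size_map size_enum_ord nth_map_enum; apply.
Qed.

Lemma asm_v_state n (A : 'M[asm_entry]_n) i j : A \in ASM n ->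
  asm_int A i j != 0 -> asm_int A i j = flip (v_state (asm_int A) i j).
Proof.
move=> /(asm_colP j)/run_state - /(_ i).
by rewrite size_map size_enum_ord nth_map_enum; apply.
Qed.

Lemma straightC (R : comNzRingType) d (u v : R) :
  straight (~~ d) u v = straight d v u.
Proof. by case: d; rewrite /straight /= mulrC. Qed.

Lemma ASM_tr n (A : 'M[asm_entry]_n) : (A^T \in ASM n) = (A \in ASM n).
Proof.
rewrite !inE /is_asm andbC; congr (_ && _);
  by apply: eq_forallb => i; congr asm_line; apply: eq_map => j; rewrite !mxE.
Qed.

(** Transposition exchanges the two edges at each entry, and [straight (~~ d)] is [straight d] with
    its arguments exchanged. At a nonzero entry the two edges agree, since the sign of the entry
    determines both. *)
Lemma dwbc_tr (R : comNzRingType) d (us vs : seq R) : size us = size vs ->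
  dwbc d us vs = dwbc (~~ d) vs us.
Proof.
move=> szuv; rewrite (dwbc_sum _ szuv (erefl _)) (dwbc_sum _ (erefl _) szuv).
rewrite (reindex_inj (@trmx_inj _ _ _)) /=.
apply: eq_big => [A|A]; rewrite ASM_tr // => ASM_A.
rewrite exchange_big /=; apply: eq_bigr => i _; apply: eq_bigr => j _.
have trE i' j' : asm_int A^T i' j' = asm_int A j' i' by rewrite !mxE.
have -> : h_state (asm_int A^T) j i = v_state (asm_int A) i j.
  by congr state; apply: eq_map => k.
have -> : v_state (asm_int A^T) j i = h_state (asm_int A) i j.
  by congr state; apply: eq_map => k.
rewrite trE /vertex; case: eqP => [_|/eqP a0].
  by rewrite addNb straightC eq_sym.
rewrite (mulrC (turn _)); congr (if _ then _ else _).
have /eqP := asm_h_state ASM_A a0; rewrite (asm_v_state ASM_A a0).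
by case: (v_state _ i j); case: (h_state _ i j).
Qed.

(** * Symmetries of the partition function *)

Section Naturality.
Variables (R R' : comNzRingType) (phi : {rmorphism R -> R'}).

Lemma rmorph_straight d (u v : R) :
  phi (straight d u v) = straight d (phi u) (phi v).
Proof. by rewrite /straight; case: d; rewrite rmorphD rmorphB rmorphM rmorph1.
  Qed.

Lemma rmorph_turn (u : R) : phi (turn u) = turn (phi u).
Proof. by rewrite /turn rmorphD rmorphB rmorphXn rmorph1. Qed.

Lemma rmorph_transfer d u vs l r f s :
  phi (transfer d u vs l r f s)
  = transfer d (phi u) (map phi vs) l r (phi \o f) s.
Proof.
elim: vs l f s => [|v vs IH] l f [|x s] /=;
  rewrite ?rmorphM ?rmorph_nat // rmorphD !rmorphM rmorph_straight rmorph_nat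
    !IH.
congr (_ + _ * _ * _).
by case: l; rewrite ?rmorph1 // rmorphM !rmorph_turn.
Qed.

Lemma rmorph_dwbc d us vs : phi (dwbc d us vs) =
  dwbc d (map phi us) (map phi vs).
Proof.
rewrite /dwbc size_map; have: size (nseq (size vs) false) = size vs.
  by rewrite size_nseq.
elim: us (nseq _ _) => [|u us IH] s szs /=; first by rewrite rmorph_nat.
by rewrite rmorph_transfer; apply: eq_transfer => [|t] /=;
  rewrite size_map // => /IH.
Qed.

End Naturality.

(** For [sigma x] = 1 - 1/x, introduced below, these conditions make each [sigma x] defined, nonzero
    and different from all parameters, so that the interpolation points are distinct. *)
Definition generic (K : fieldType) (s : seq K) : bool :=
  [&& uniq s, 0 \notin s, 1 \notin s
    & all (fun x => all (fun y => straight true x y != 0) s) s].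

(** This captures the polynomials with integer coefficients in the entries of a list. *)
Definition natural (f : forall R : comNzRingType, seq R -> R) : Prop :=
  forall (R R' : comNzRingType) (phi : {rmorphism R -> R'}) s,
    phi (f R s) = f R' (map phi s).

(** Each inequality is witnessed by an evaluation at a point with coordinates 0 and 1 that separates
    its sides. *)
Lemma generic_indets (K : fieldType) N :
  generic [seq tofrac ('X_i : {mpoly K[N]}) | i <- enum 'I_N].
Proof.
have tofrac_inj : injective (tofrac (R:={mpoly K[N]})).
  by move=> p q /eqP; rewrite tofrac_eq => /eqP.
rewrite (map_comp (tofrac (R:={mpoly K[N]}))).
apply/and4P; split.
- rewrite map_inj_uniq; last by [].
  rewrite map_inj_uniq ?enum_uniq // => i j /(congr1 (meval (fun k =>
    (k == i)%:R))).
  rewrite !mevalXU eqxx; case: eqP => // _ /eqP; by rewrite oner_eq0.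
- apply/mapP => -[_ /mapP[i _ ->]] /esym/eqP; rewrite tofrac_eq0 => /eqP.
  move/(congr1 (meval (fun k => 1))); rewrite mevalXU meval0 /= => /eqP.
  by rewrite oner_eq0.
- apply/mapP => -[_ /mapP[i _ ->]]; rewrite -tofrac1 => /tofrac_inj.
  move/(congr1 (meval (fun k => 0))); rewrite mevalXU meval1 /= => /eqP.
  by rewrite oner_eq0.
apply/allP => _ /mapP[_ /mapP[i _ ->] ->].
apply/allP => _ /mapP[_ /mapP[j _ ->] ->].
rewrite -rmorph_straight tofrac_eq0; apply/eqP.
move/(congr1 (meval (fun k => 0))).
rewrite /straight mevalD mevalB mevalM !mevalXU meval1 meval0 => /eqP.
by rewrite mul0r subr0 add0r oner_eq0.
Qed.

(* Apply the identity to the indeterminates of K(X_1, ..., X_N), then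
   evaluate it. *)
Lemma generic_ext (f g : forall R : comNzRingType, seq R -> R) N :
  natural f -> natural g ->
  (forall (K : fieldType) (s : seq K), size s = N -> generic s ->
    f K s = g K s) ->
  forall (K : fieldType) (s : seq K), size s = N -> f K s = g K s.
Proof.
move=> fN gN fg K s szs.
pose X := [seq 'X_i : {mpoly K[N]} | i <- enum 'I_N].
have szX : size X = N by rewrite size_map size_enum_ord.
have: f _ X = g _ X.
  apply/eqP; rewrite -tofrac_eq; apply/eqP;
    rewrite (fN _ _ (tofrac (R:={mpoly K[N]}))) (gN _ _ (tofrac (R:={mpoly
    K[N]}))).
  have := fg {fraction {mpoly K[N]}} (map (tofrac (R:={mpoly K[N]})) X).
  rewrite size_map; apply=> //.
  by rewrite -map_comp; apply: generic_indets.
move/(congr1 (meval (fun i => s`_i))); rewrite fN gN.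
have -> // : map (meval (fun i => s`_i)) X = s.
apply: (@eq_from_nth _ 0) => [|i]; rewrite size_map szX // => iN.
by rewrite (nth_map 0) ?szX // (nth_map_enum _ _ (Ordinal iN)) mevalXU.
Qed.

(** * Symmetry in the rows and in the columns *)

Lemma perm_swap_eq (T : eqType) (U : Type) (F : seq T -> U) (a : pred T) :
  (forall s1 x y s2, all a (s1 ++ x :: y :: s2) ->
     F (s1 ++ x :: y :: s2) = F (s1 ++ y :: x :: s2)) ->
  forall s s', all a s -> perm_eq s s' -> F s = F s'.
Proof.
move=> swapF.
(* Adjacent exchanges bring any element to the front of the part after [p], which holds the elements
   already in place. *)
have front x s1 s2 p : all a (p ++ s1 ++ x :: s2) ->
    F (p ++ s1 ++ x :: s2) = F (p ++ x :: s1 ++ s2).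
  elim/last_ind: s1 s2 => [|s1 y IH] s2 //; rewrite !cat_rcons => ha.
  rewrite catA swapF -?catA // IH //.
  by move: ha; rewrite !all_cat /= => /and5P[-> -> -> -> ->].
suff gen p s s' : all a (p ++ s) -> perm_eq s s' -> F (p ++ s) = F (p ++ s').
  by move=> s s'; apply: (gen [::]).
elim: s' p s => [|x s' IH] p s ha => [/perm_nilP-> //|ps].
have xs: x \in s by rewrite (perm_mem ps) mem_head.
case/splitPr: xs ps ha => s1 s2 ps ha; rewrite front //
  -cat_rcons IH ?cat_rcons //.
  by move: ha; rewrite !all_cat /= !all_cat => /and4P[-> -> -> ->].
by rewrite -(perm_cons x) -(permPr ps) -[x :: _]/([:: x] ++ _) perm_catCA.
Qed.

Lemma rmorph_nth (R R' : comNzRingType) (phi : {rmorphism R -> R'}) s i :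
  phi s`_i = (map phi s)`_i.
Proof.
by case: (ltnP i (size s)) => si; [rewrite (nth_map 0) |
  rewrite !nth_default ?size_map ?rmorph0].
Qed.

Lemma rmorph_nths (R R' : comNzRingType) (phi : {rmorphism R -> R'}) s I :
  [seq phi i | i <- [seq s`_i | i <- I]] = [seq (map phi s)`_i | i <- I].
Proof. by rewrite -map_comp; apply: eq_map => i /=; rewrite rmorph_nth. Qed.

Lemma domain_wall_swap (R : idomainType) d (us1 us2 vs : seq R) x y s :
  straight (~~ d) x y != 0 -> size s = size vs ->
  domain_wall d (us1 ++ x :: y :: us2) vs s
  = domain_wall d (us1 ++ y :: x :: us2) vs s.
Proof.
move=> xy0; elim: us1 s => [|u us1 IH] s szs /=.
  by apply: (mulfI xy0); apply: transferC.
exact: eq_transfer.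
Qed.

(** For generic parameters the crossing weights in [transferC] are nonzero and cancel. Naturality
    then extends the symmetry to all parameters. *)
Lemma dwbc_perm_rows (K : fieldType) d (us us' vs : seq K) : perm_eq us us' ->
  dwbc d us vs = dwbc d us' vs.
Proof.
rewrite perm_sym => /(perm_iotaP 0)[Is pI ->].
(* Both sides become index lists into the single list [us ++ vs], the form that [generic_ext]
   requires. *)
pose f I (R : comNzRingType) (s : seq R) :=
  dwbc d [seq s`_i | i <- I] [seq s`_i | i <- iota (size us) (size vs)].
have fN I : natural (f I).
  by move=> R R' phi s; rewrite /f rmorph_dwbc !rmorph_nths.
pose n := (size us + size vs)%N.
have := @generic_ext _ _ n (fN (iota 0 (size us))) (fN Is) _ K (us ++ vs).
rewrite /f map_nth_iota0 ?size_cat ?leq_addr // take_size_cat //.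
rewrite map_nth_iota ?size_cat ?addKn // drop_size_cat // take_size.
have -> : [seq (us ++ vs)`_i | i <- Is] = [seq us`_i | i <- Is].
  by apply/eq_in_map => i; rewrite (perm_mem pI) mem_iota nth_cat =>
    /andP[_ ->].
apply => // {fN} F s szs /and4P[_ _ _ /allP gen]; rewrite /f {f}.
set ws := map _ (iota (size us) _).
apply: (perm_swap_eq (F := fun us => dwbc d us ws) (a := mem s)); last 1 first.
- by apply: perm_map; rewrite perm_sym.
- move=> s1 x y s2; rewrite all_cat /= => /and4P[_ xs ys _].
  rewrite /dwbc; apply: domain_wall_swap; rewrite ?size_nseq //.
  by case: (d); [rewrite (straightC true) | ]; apply: (allP (gen _ _)).
apply/allP => z /mapP[i]; rewrite mem_iota => ius ->; apply: mem_nth.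
by rewrite szs /n; lia.
Qed.

Lemma dwbc_perm_cols (K : fieldType) d (us vs vs' : seq K) :
  size us = size vs -> perm_eq vs vs' -> dwbc d us vs = dwbc d us vs'.
Proof.
move=> szuv pv; rewrite dwbc_tr // [RHS]dwbc_tr -?(perm_size pv) //.
exact: dwbc_perm_rows.
Qed.

(** In [u] a zero entry has degree at most 1, an entry 1 degree 0 and an entry -1 degree 2. From the
    left edge 0 the row has one more 1 than -1, which saves one degree; from the left edge 1 it has
    equally many. *)
Lemma transfer_poly (K : fieldType) d (vs : seq K) (l : bool) f s :
  exists2 P : {poly K}, (size P <= size vs + l)%N &
    forall u, transfer d u vs l true f s = P.[u].
Proof.
elim: vs l f s => [|v vs IH] l f s /=.
  exists (l%:R * f [::])%:P; last by move=> u; rewrite hornerC; case: l.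
  by case: l; rewrite ?mul0r ?polyC0 ?size_poly0 // size_polyC_leq1.
case: s => [|x s].
  exists (l%:R * f [::])%:P; last by move=> u; rewrite hornerC; case: l.
  by apply: leq_trans (size_polyC_leq1 _) _.
have [P szP PE] := IH l (fun t => f (x :: t)) s.
have [Q szQ QE] := IH (~~ l) (fun t => f (~~ x :: t)) s.
pose S : {poly K} := if d (+) (l == x) then 'X * v%:P - 'X + 1 else 'X * v%:P
  - v%:P + 1.
pose T : {poly K} := if l then ('X ^+ 2 - 'X + 1) * (turn v)%:P else 1.
exists (S * P + (l == x)%:R * T * Q); last first.
  move=> u; rewrite PE QE !hornerE /S /T /straight /turn.
  by case: l {PE QE szP szQ IH S T}; case: d; case: x; rewrite /= ?hornerE.
have szM (p q : {poly K}) a b : (size p <= a.+1 -> size q <= b ->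
  size (p * q)%R <= a + b)%N.
  by move=> pa qb; apply: leq_trans (size_polyMleq _ _) _; lia.
have szD (p q : {poly K}) a : (size p <= a -> size q <= a ->
  size (p + q)%R <= a)%N.
  by move=> pa qa; apply: leq_trans (size_polyD _ _) _; rewrite geq_max pa.
have szC c : (size (c%:P : {poly K}) <= 1)%N := size_polyC_leq1 c.
have szN (p : {poly K}) a : (size p <= a -> size (- p)%R <= a)%N.
  by rewrite size_polyN.
have szX : (size ('X : {poly K}) <= 2)%N by rewrite size_polyX.
have szXv : (size ('X * v%:P)%R <= 2)%N by apply: (szM _ _ 1%N 1%N).
have szC2 c : (size (c%:P : {poly K}) <= 2)%N by apply: leq_trans (szC c) _.
have szC3 c : (size (c%:P : {poly K}) <= 3)%N by apply: leq_trans (szC c) _.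
have szS : (size S <= 2)%N.
  rewrite /S -polyC1.
  by case: ifP => _; apply: (szD _ _ _ _ (szC2 _)); apply: szD => //;
    apply: szN.
have szT : (size T <= 1 + l + l)%N.
  rewrite /T; case: (l); last by rewrite size_poly1.
  rewrite -polyC1; apply: (szM _ _ 2%N 1%N) => //.
  apply: (szD _ _ _ _ (szC3 _)); apply: szD; first by rewrite size_polyXn.
  by apply: szN; apply: leq_trans szX _.
apply: szD.
  by apply: leq_trans (szM _ _ 1%N _ szS szP) _; lia.
rewrite -mulrA -polyC_natr; apply: leq_trans (szM _ _ 0%N _ (szC _) (leqnn _))
  _.
by apply: leq_trans (szM _ _ (l + l)%N _ szT szQ) _;
  case: l {PE QE szP szQ IH S T szS szT}; rewrite /= ; lia.

Qed.

(** A nonzero entry needs equal left and top edges, so a row with left edge 1 below top edges 0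
    consists of zeros. *)
Lemma transfer_frozen (R : comNzRingType) d (u : R) vs f :
  transfer d u vs true true f (nseq (size vs) false)
  = \prod_(v <- vs) straight d u v * f (nseq (size vs) false).
Proof.
elim: vs f => [|v vs IH] f /=; first by rewrite big_nil.
by rewrite IH big_cons addbF !mul0r addr0 mulrA.
Qed.

(** Every row enters the first column with edge 0, so this column consists of zeros when its top
    edge is 1. *)
Lemma domain_wall_frozen (R : comNzRingType) d us (v : R) vs s :
  size s = size vs ->
  domain_wall d us (v :: vs) (true :: s)
  = \prod_(u <- us) straight d u v * domain_wall d us vs s.
Proof.
elim: us s => [|u us IH] s szs /=; first by rewrite big_nil mul1r.
rewrite big_cons addbF !mul0r addr0 -mulrA; congr (_ * _).
set c := \prod_(_ <- _) _.
rewrite (@eq_transfer _ _ _ _ _ _ _ (fun t =>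
  c * domain_wall d us vs t + 0 * 0)) //.
  by rewrite (transferD _ _ _ _ _ _ (fun=> 0)) mul0r addr0.
by move=> t szt; rewrite IH // mul0r addr0.
Qed.

(** A corner that cannot be 0 is 1, and this freezes the rest of the first row and of the first
    column. *)
Lemma dwbc_corner (R : comNzRingType) d (u : R) us v vs :
  straight (~~ d) u v = 0 ->
  dwbc d (u :: us) (v :: vs) = \prod_(w <- vs) straight d u w
    * \prod_(w <- us) straight d w v * dwbc d us vs.
Proof.
move=> uv0; rewrite /dwbc /= addbT uv0 mul0r add0r !mul1r transfer_frozen.
by rewrite domain_wall_frozen ?size_nseq // mulrA.
Qed.

(** * Interpolation, and the exchange of a row parameter with a column parameter *)

Definition polyfun (K : fieldType) n (f : K -> K) : Prop :=
  exists2 P : {poly K}, (size P <= n)%N & forall x, f x = P.[x].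

Lemma polyfun_ext (K : fieldType) n (f g : K -> K) (s : seq K) :
  polyfun n f -> polyfun n g -> uniq s -> (n <= size s)%N ->
  {in s, f =1 g} -> f =1 g.
Proof.
move=> [P szP fP] [Q szQ gQ] us ns fg x; rewrite fP gQ; congr _.[x].
apply/eqP; rewrite -subr_eq0; apply/eqP.
apply: (roots_geq_poly_eq0 (rs := s)) => //.
  by apply/allP => y ys; rewrite rootE hornerD hornerN -fP -gQ fg ?subrr.
rewrite (leq_trans (size_polyD _ _)) // size_polyN geq_max.
by rewrite !(leq_trans _ ns).
Qed.

Lemma polyfun_row (K : fieldType) d (us vs : seq K) :
  polyfun (size vs) (fun u => dwbc d (u :: us) vs).
Proof.
have [P szP PE] := transfer_poly d vs false (domain_wall d us vs) (nseq (size
  vs) false).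
by exists P; rewrite ?addn0 in szP *.
Qed.

Lemma polyfun_col (K : fieldType) d (us vs : seq K) : size us = (size vs).+1 ->
  polyfun (size us) (fun v => dwbc d us (v :: vs)).
Proof.
move=> szuv; have [P szP PE] := polyfun_row (~~ d) vs us.
by exists P => // v; rewrite dwbc_tr.
Qed.

(* The row parameter whose [straight false] weight against column x vanishes. *)
Definition sigma (K : fieldType) (x : K) : K := 1 - x^-1.

Lemma sigma_inj (K : fieldType) : injective (@sigma K).
Proof. by move=> x y /addrI/oppr_inj/invr_inj. Qed.

Section Generic.
Variable K : fieldType.
Implicit Types (x y : K) (s : seq K).

Lemma generic_neq s x y : generic s -> x \in s -> y \in s ->
  [/\ x != 0, x != 1 & straight true x y != 0].
Proof.
case/and4P => _ s0 s1 /allP/= st xs ys; split.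
- by apply: contraNneq s0 => <-.
- by apply: contraNneq s1 => <-.
by have /allP := st x xs; apply.
Qed.

Lemma sub_generic s s' : uniq s' -> {subset s' <= s} -> generic s -> generic s'.
Proof.
move=> us' ss' g; have [u s0 s1 st] := and4P g; apply/and4P; split=> //.
- by apply: contra s0 => /ss'.
- by apply: contra s1 => /ss'.
by apply/allP => x /ss' xs; apply/allP => y /ss' ys;
  case: (generic_neq g xs ys).
Qed.

Lemma straight_sigmaF x y : x != 0 -> straight false (sigma x) y = (x - y) / x.
Proof. by move=> x0; rewrite /straight /sigma; field. Qed.

Lemma straight_sigmaT x y : x != 0 ->
  straight true (sigma x) y = straight true y x / x.
Proof. by move=> x0; rewrite /straight /sigma; field. Qed.

Lemma straight_sigmar x : x != 0 -> straight true x (sigma x) = 0.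
Proof. by move=> x0; rewrite /straight /sigma; field. Qed.

Lemma straight_sigma0 x : x != 0 -> straight false (sigma x) x = 0.
Proof. by move=> x0; rewrite straight_sigmaF // subrr mul0r. Qed.

Lemma sigma_eq x y : x != 0 -> (sigma x == y) = (straight true x y == 0).
Proof.
move=> x0; rewrite -subr_eq0 -[LHS](mulrI_eq0 _ (mulfI x0)) -oppr_eq0.
by congr (_ == 0); rewrite /straight /sigma; field.
Qed.
End Generic.

Lemma dwbc_sigma (K : fieldType) (us vs : seq K) x : x != 0 ->
  dwbc true (sigma x :: us) (x :: vs)
  = \prod_(w <- vs) straight true (sigma x) w
    * \prod_(w <- us) straight true w x * dwbc true us vs.
Proof. by move=> x0; rewrite dwbc_corner // straight_sigma0. Qed.

(* Both sides are polynomials of degree at most n in p, equal at p = q; at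
   p = sigma v, with v in V, they are polynomials in q, equal at q = p,
   q = sigma p and q = sigma w for the other w in V. *)
Lemma dwbc_swap n (K : fieldType) (p q : K) U V : size U = n -> size V = n ->
  dwbc true (p :: U) (q :: V) = dwbc true (q :: U) (p :: V).
Proof.
elim: n K p q U V => [|n IH] K p q U V szU szV.
  by case: U V szU szV => [|? ?] [|? ?] //= _ _; rewrite /dwbc /=; ring.
(* [f false] and [f true] are the two sides as natural functions of the list [p :: q :: U ++ V]. *)
pose f (b : bool) (R : comNzRingType) (s : seq R) :=
  dwbc true (s`_b :: take n.+1 (drop 2 s)) (s`_(~~ b) :: drop n.+1 (drop 2 s)).
have fN b : natural (f b).
  by move=> R R' phi s; rewrite /f rmorph_dwbc /= map_take !map_drop
    !rmorph_nth.
have := @generic_ext _ _ (2 + n.+1 + n.+1) (fN false) (fN true) _ K (p :: q ::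
  U ++ V).
rewrite /f /= !drop0 take_size_cat // drop_size_cat //; apply; last first.
  by rewrite /= size_cat szU szV; lia.
move=> {p q U V szU szV fN f} {}K [|p [|q W]] //= szW gen.
rewrite drop0; set U := take _ W; set V := drop _ W.
have szU : size U = n.+1 by rewrite size_takel //; lia.
have szV : size V = n.+1 by rewrite size_drop; lia.
(* Genericity is kept only for the parameters other than [p], which becomes the variable of
   interpolation. *)
have {}gen : generic (q :: U ++ V).
  rewrite cat_take_drop; apply: (sub_generic _ _ gen);
    first by case/and4P: gen => /andP[].
  by move=> x xs; rewrite inE xs orbT.
clearbody U V; clear W szW.
have neq := generic_neq gen.
have V0 v : v \in V -> v != 0.
  by move=> vV; have [] := neq v v; rewrite ?inE ?mem_cat ?vV ?orbT.
have uV : uniq V by case/and4P: gen => /= /andP[_];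
  rewrite cat_uniq => /and3P[].
have step v : v \in V -> forall r,
    dwbc true (sigma v :: U) (r :: V) = dwbc true (r :: U) (sigma v :: V).
  move=> vV; have pV := perm_to_rem vV; have v0 := V0 v vV.
  have [_ v1 vv] : [/\ v != 0, v != 1 & straight true v v != 0].
    by apply: neq; rewrite ?inE ?mem_cat ?vV ?orbT.
  set x := sigma v; set V' := rem v V in pV.
  have szV' : size V' = n by rewrite size_rem // szV.
  have V'V w : w \in V' -> w \in V by move/mem_rem.
  have x0 : x != 0 by rewrite subr_eq0 eq_sym invr_eq1.
  have colV A a : size A = n.+2 -> dwbc true A (a :: V) =
    dwbc true A (v :: a :: V').
    move=> szA; apply: dwbc_perm_cols; first by rewrite szA /= szV.
    rewrite (permPl (_ : perm_eq _ (a :: v :: V'))) ?perm_cons //.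
    by apply/permP => t /=; rewrite addnCA.
  apply: (@polyfun_ext _ n.+2 _ _ (x :: sigma x :: map (@sigma K) V')).
  - by have := @polyfun_col _ true (x :: U) V; rewrite /= szU szV; apply.
  - by have := @polyfun_row _ true U (x :: V); rewrite /= szV.
  - have sigV w : w \in V -> sigma v != w.
      move=> wV; rewrite sigma_eq //.
      by have [] := neq v w _ _; rewrite ?inE ?mem_cat ?vV ?wV ?orbT.
    rewrite /= (map_inj_uniq (@sigma_inj K)) rem_uniq ?uV // inE negb_or andbT.
    rewrite -{1}[x]/(sigma v) !(mem_map (@sigma_inj K)) (inj_eq (@sigma_inj K)).
    rewrite mem_rem_uniqF // andbT eq_sym sigV //=.
    by apply/negP => /V'V/sigV; rewrite eqxx.
  - by rewrite /= size_map szV'.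
  move=> r; rewrite !inE => /or3P[/eqP->//|/eqP->|/mapP[w wV' ->]].
    (* At [r = sigma x] both sides vanish: once a corner is removed, the left side has the factor
       [straight true x (sigma x)] and the right side, as [x = sigma v], the factor
       [straight true (sigma x) v]. *)
    rewrite colV /= ?szU // dwbc_sigma // big_cons.
    rewrite straight_sigmar // !mul0r dwbc_corner;
      last by rewrite straight_sigma0.
    rewrite (perm_big _ pV) big_cons.
    have -> : straight true (sigma x) v = 0.
      by rewrite straight_sigmaT // straight_sigmar // mul0r.
    by rewrite /= !mul0r.
  have pV' := perm_to_rem wV'; set V'' := rem w V' in pV'.
  have w0 := V0 w (V'V w wV').
  have szV'' : size V'' = n.-1 by rewrite size_rem // szV'.
  case: n IH szU szV szV' szV'' wV' colV => [|m] IH szU szV szV' szV'' wV' colV.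
    by rewrite (size0nil szV') in wV'.
  case: U szU gen neq => [|u U'] // [szU'] gen neq.
  have v_w : v != w by apply: contraTneq wV' => <-; rewrite mem_rem_uniqF.
  (* With the first corner removed, the other special parameter and its [sigma] are both columns.
     The induction hypothesis exchanges [sigma y] with the row parameter [u], which creates a second
     corner. *)
  have inner y : y != 0 -> dwbc true (u :: U') (sigma y :: y :: V'')
      = straight true u y / y * \prod_(z <- V'') straight true (sigma y) z
        * \prod_(z <- U') straight true z y * dwbc true U' (u :: V'').
    move=> y0; rewrite IH //= ?szV'' //.
    rewrite (@dwbc_perm_cols _ _ _ _ (y :: u :: V'')) /= ?szU' ?szV'' //;
      last first.
      by apply/permP => t /=; rewrite addnCA.
    by rewrite dwbc_sigma // big_cons straight_sigmaT.
  (* Removing both corners leaves a formula symmetric in [y] and [z]. *)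
  have outer y z : y != 0 -> z != 0 ->
      dwbc true (sigma y :: u :: U') (y :: sigma z :: z :: V'')
      = dwbc true (sigma z :: u :: U') (z :: sigma y :: y :: V'').
    move=> y0 z0; rewrite !dwbc_sigma // !inner // !big_cons /=.
    move: (\big[_/_]_(_ <- _) _) (\big[_/_]_(_ <- U') _) (\big[_/_]_(_ <- _) _)
      (\big[_/_]_(_ <- U') _) (dwbc _ _ _) => c1 c2 c3 c4 D.
    by rewrite /straight /sigma; field; rewrite y0 z0.
  have colE A a b c : perm_eq (b :: c :: V'') V -> size A = m.+3 ->
    dwbc true A (a :: V) = dwbc true A (b :: a :: c :: V'').
    move=> pbc szA; apply: dwbc_perm_cols; first by rewrite szA /= szV.
    rewrite -(permPr (_ : perm_eq (a :: b :: c :: V'') _)) ?perm_cons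
      1?perm_sym //.
    by apply/permP => t /=; rewrite addnCA.
  have pvw : perm_eq (v :: w :: V'') V.
    by rewrite perm_sym (permPl pV) perm_cons.
  have pwv : perm_eq (w :: v :: V'') V.
    by rewrite -(permPr pvw); apply/permP => t /=; rewrite addnCA.
  have szC a : size (a :: u :: U') = m.+3 by rewrite /= szU'.
  by rewrite (colE _ _ _ _ pvw (szC _)) (colE _ _ _ _ pwv (szC _)) outer.
move: p; apply: (@polyfun_ext _ n.+2 _ _ (q :: map (@sigma K) V)) => [||||r].
- by have := @polyfun_row _ true U (q :: V); rewrite /= szV.
- by have := @polyfun_col _ true (q :: U) V; rewrite /= szU szV; apply.
- rewrite /= (map_inj_uniq (@sigma_inj K)) uV andbT.
  apply/mapP => -[v vV] /esym/eqP; rewrite sigma_eq ?V0 //; apply/negP.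
  by have [] := neq v q _ _; rewrite ?inE ?mem_cat ?vV ?orbT ?eqxx.
- by rewrite /= size_map szV.
rewrite inE => /orP[/eqP->//|/mapP[v vV ->]]; exact: step.
Qed.

(** The wanted rows are collected in [p] one at a time. A parameter found among the rows moves by
    row symmetry; one found among the columns first becomes a row by [dwbc_swap]. *)
Lemma dwbc_perm (K : fieldType) (us us' vs vs' : seq K) :
  size us = size vs -> size us' = size vs' -> perm_eq (us ++ vs) (us' ++ vs') ->
  dwbc true us vs = dwbc true us' vs'.
Proof.
suff gen p (U U' V V' : seq K) : size (p ++ U) = size V -> size U = size U' ->
    perm_eq (U ++ V) (U' ++ V') -> dwbc true (p ++ U) V =
      dwbc true (p ++ U') V'.
  move=> szuv szuv' pE; apply: (gen [::]) => //.
  by have := perm_size pE; rewrite !size_cat -szuv -szuv' !addnn => /double_inj.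
elim: U' U p V => [|x U' IH] U p V szpU szUU' pE.
  by rewrite (size0nil szUU') in pE szpU *; apply: dwbc_perm_cols.
have: x \in U ++ V by rewrite (perm_mem pE) mem_head.
have row (y : K) W : p ++ y :: W = rcons p y ++ W by rewrite cat_rcons.
rewrite mem_cat => /orP[xU|xV].
  have pU := perm_to_rem xU.
  rewrite (@dwbc_perm_rows _ _ _ (p ++ x :: rem x U)) ?perm_cat2l // !row.
  apply: IH; first by rewrite -row -szpU !size_cat (perm_size pU).
    by apply: succn_inj; rewrite -[RHS]szUU' (perm_size pU).
  by rewrite -(perm_cons x) -cat_cons -(permPl (_ : perm_eq (U ++ V) _))
    ?perm_cat2r.
case: U => [//|y U] in szpU szUU' pE *.
have pV := perm_to_rem xV.
have szV : size (rem x V) = size (p ++ U).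
  by apply: succn_inj; rewrite -[LHS](perm_size pV) -szpU !size_cat addnS.
rewrite (@dwbc_perm_cols _ _ _ _ (x :: rem x V)) //.
rewrite (@dwbc_perm_rows _ _ _ (y :: p ++ U));
  last by rewrite perm_sym -cat_rcons -cat1s perm_catCA cat_rcons.
rewrite (dwbc_swap _ _ _ szV) //.
rewrite (@dwbc_perm_rows _ _ _ (p ++ x :: U));
  last by rewrite -[x :: _]cat1s -[x :: U]cat1s perm_catCA.
rewrite !row; apply: IH => /=.
- by rewrite szV !size_cat size_rcons addSn.
- by case: szUU'.
rewrite -(perm_cons x) -cat_cons -(permPr pE).
by apply/permP => a; have /permP/(_ a) := pV; rewrite /= !count_cat /= => ->;
  lia.
Qed.

(** By the symmetry in all parameters it does not matter which half of the list serves as rows. *)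
Definition dwbc1 (R : comNzRingType) (s : seq R) : R :=
  dwbc true (take (size s)./2 s) (drop (size s)./2 s).

(** Its inverse is the matrix entry in the Izergin-Korepin determinant. *)
Definition cross (R : comNzRingType) (x y : R) : R :=
  straight true x y * straight false x y.

(** * The partition function of a single list of parameters *)

Section Dwbc1.
Variable K : fieldType.
Implicit Types (s R : seq K) (x y p q r t v w : K).

Lemma dwbc1_perm s s' : ~~ odd (size s) -> perm_eq s s' -> dwbc1 s = dwbc1 s'.
Proof.
move=> ev pE; rewrite /dwbc1 -(perm_size pE).
have szh (z : seq K) : size z = size s ->
    size (take (size s)./2 z) = size (drop (size s)./2 z).
  move=> szz; rewrite size_takel ?size_drop szz;
    last by rewrite -{2}(even_halfK ev) -addnn leq_addr.
  by rewrite -{2}(even_halfK ev) -addnn addKn.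
by apply: dwbc_perm; rewrite ?cat_take_drop ?szh // (perm_size pE).
Qed.

Lemma dwbc1_cat (us vs : seq K) : size us = size vs ->
  dwbc1 (us ++ vs) = dwbc true us vs.
Proof.
by move=> szuv; rewrite /dwbc1 size_cat -szuv addnn doubleK take_size_cat //
  drop_size_cat.
Qed.

Lemma split_half n R : size R = n.*2 ->
  exists us vs, [/\ R = us ++ vs, size us = n & size vs = n].
Proof.
move=> szR; exists (take n R), (drop n R);
  rewrite cat_take_drop size_takel ?szR -?addnn ?leq_addr //.
by rewrite size_drop szR -addnn addKn.
Qed.

Lemma polyfun_dwbc1 n R : size R = n.*2.+1 -> polyfun n.+1 (fun x =>
  dwbc1 (x :: R)).
Proof.
case/lastP: R => // R y; rewrite size_rcons =>
  -[/split_half[us [vs [-> szu szv]]]].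
have [P szP PE] := polyfun_row true us (rcons vs y).
exists P; first by rewrite -szv -(size_rcons vs y).
by move=> x; rewrite rcons_cat -cat_cons dwbc1_cat // size_rcons szv /= szu.
Qed.

Lemma dwbc1_sigma n R x : size R = n.*2 -> x != 0 ->
  dwbc1 (sigma x :: x :: R)
  = \prod_(w <- R) straight true w x * x^-1 ^+ n * dwbc1 R.
Proof.
move=> szR x0; have [us [vs [RE szu szv]]] := split_half szR.
rewrite (@dwbc1_perm _ ((sigma x :: us) ++ x :: vs)); last 2 first.
- by rewrite /= szR odd_double.
- by rewrite RE; apply/permP => a; rewrite /= !count_cat /=; lia.
rewrite dwbc1_cat /= ?szu ?szv // dwbc_sigma // RE dwbc1_cat ?szu ?szv //.
have -> : \prod_(w <- vs) straight true (sigma x) w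
    = \prod_(w <- vs) straight true w x * x^-1 ^+ n.
  rewrite -szv; elim: (vs) => [|w ws IH]; first by rewrite !big_nil mulr1.
  by rewrite !big_cons IH straight_sigmaT //= exprS; ring.
by rewrite big_cat /=; ring.
Qed.

Lemma polyfunZ n c f : polyfun n f -> polyfun n (fun x : K => c * f x).
Proof.
case=> P szP PE; exists (c *: P); last by move=> x; rewrite hornerZ PE.
exact: leq_trans (size_scale_leq _ _) szP.
Qed.

Lemma polyfunD n f g : polyfun n f -> polyfun n g -> polyfun n (fun x : K =>
  f x + g x).
Proof.
case=> P szP PE [Q szQ QE]; exists (P + Q); last by move=> x;
  rewrite hornerD PE QE.
by rewrite (leq_trans (size_polyD _ _)) // geq_max szP.
Qed.

Lemma polyfunM m n f g : polyfun m.+1 f -> polyfun n g ->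
  polyfun (m + n) (fun x : K => f x * g x).
Proof.
case=> P szP PE [Q szQ QE]; exists (P * Q); last by move=> x;
  rewrite hornerM PE QE.
by rewrite (leq_trans (size_polyMleq _ _)) //; lia.
Qed.

Lemma polyfun_lin a b : polyfun 2 (fun x : K => a * x + b).
Proof.
exists (a *: 'X + b%:P); last by move=> x; rewrite !hornerE.
rewrite (leq_trans (size_polyD _ _)) // geq_max (leq_trans (size_scale_leq _
  _)) ?size_polyX //.
by rewrite (leq_trans (size_polyC_leq1 _)).
Qed.

Lemma eq_polyfun n f g : (forall x : K, f x = g x) -> polyfun n f ->
  polyfun n g.
Proof. by move=> fg [P szP PE]; exists P => // x; rewrite -fg. Qed.

Lemma polyfun0 n : polyfun n (fun _ : K => 0).
Proof. by exists 0; rewrite ?size_poly0 // => x; rewrite horner0. Qed.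

Lemma polyfun_cross_r y : polyfun 3 (@cross K y).
Proof.
apply: (@polyfunM 1 2); [apply: eq_polyfun (polyfun_lin y (1 - y)) | apply:
  eq_polyfun (polyfun_lin (y - 1) 1)];
by move=> x; rewrite /straight; ring.
Qed.

Lemma polyfun_cross_l y : polyfun 3 (fun x : K => cross x y).
Proof.
apply: (@polyfunM 1 2); [apply: eq_polyfun (polyfun_lin (y - 1) 1) | apply:
  eq_polyfun (polyfun_lin y (1 - y))];
by move=> x; rewrite /straight; ring.
Qed.

End Dwbc1.

(** * Bilinear relations *)

Section Pluecker.
Variable K : fieldType.
Implicit Types (s R : seq K) (x y p q r t v w : K).

Lemma dwbc1_perm_sigma n A B x : size A = n.*2 -> x != 0 ->
  perm_eq B (sigma x :: x :: A) ->
  dwbc1 B = \prod_(w <- A) straight true w x * x^-1 ^+ n * dwbc1 A.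
Proof.
move=> szA x0 pB; rewrite -dwbc1_sigma //; apply: dwbc1_perm => //.
by rewrite (perm_size pB) /= szA negbK odd_double.
Qed.

Lemma dwbc1_swap n R x y : size R = n.*2 -> dwbc1 (x :: y :: R) =
  dwbc1 (y :: x :: R).
Proof.
move=> szR; apply: dwbc1_perm; first by rewrite /= szR negbK odd_double.
by apply/permP => a /=; lia.
Qed.

(** The left side of a three-term Pluecker relation, in which each factor adds two of the four
    parameters to [R]. *)
Definition pluecker r t v w R :=
  (r - t) * (v - w) * dwbc1 (r :: t :: R) * dwbc1 (v :: w :: R)
  + (t - v) * (r - w) * dwbc1 (t :: v :: R) * dwbc1 (r :: w :: R)
  + (v - r) * (t - w) * dwbc1 (v :: r :: R) * dwbc1 (t :: w :: R).

(** The companion of [pluecker] for [R] of odd length, with three parameters added in one factor and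
    one in the other. Each of the two expressions reduces to the other at values of [sigma]. *)
Definition mixed q r t v R :=
  (r - t) * cross v q * dwbc1 (q :: r :: t :: R) * dwbc1 (v :: R)
  + (t - v) * cross r q * dwbc1 (q :: t :: v :: R) * dwbc1 (r :: R)
  + (v - r) * cross t q * dwbc1 (q :: v :: r :: R) * dwbc1 (t :: R).

Lemma mixed_rot q r t v R : mixed q r t v R = mixed q t v r R.
Proof. by rewrite /mixed; ring. Qed.

Lemma generic_sigma s x y : generic s -> x \in s -> y \in s ->
  [/\ sigma x != y & x != 0].
Proof.
by move=> g xs ys; have [x0 _ xy] := generic_neq g xs ys; rewrite sigma_eq.
Qed.

(* At the point where the new variable annihilates one in R, the next relation
   degenerates to the previous one. *)
Lemma mixed_sigma n r t v x R R' : size R' = n.*2 -> x != 0 ->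
  perm_eq R (x :: R') ->
  mixed (sigma x) r t v R
  = - (straight true r x * straight true t x * straight true v x
       * \prod_(w <- R') straight true w x * x^-1 ^+ n.+3) * pluecker r t v x
         R'.
Proof.
move=> szR' x0 pR.
have three a b : dwbc1 (sigma x :: a :: b :: R) =
  straight true a x * straight true b x
    * \prod_(w <- R') straight true w x * x^-1 ^+ n.+1 * dwbc1 (a :: b :: R').
  rewrite (@dwbc1_perm_sigma n.+1 (a :: b :: R') _ x) ?big_cons ?mulrA //=.
    by rewrite szR' doubleS.
  by apply/permP => c; have /permP/(_ c) := pR; rewrite /= => ->; lia.
have one a : dwbc1 (a :: R) = dwbc1 (a :: x :: R').
  apply: dwbc1_perm; last by rewrite perm_cons.
  by rewrite /= (perm_size pR) /= szR' negbK odd_double.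
rewrite /mixed /pluecker !three !one /cross.
rewrite !exprS; move: (x^-1 ^+ n) (\prod_(_ <- _) _) => c1 c2.
by rewrite /straight /sigma; field.
Qed.

(** The factor [cross r (sigma r)] kills one term. In the other two [sigma r] annihilates [r], and
    the results cancel. *)
Lemma mixed_sigma3 n r t v R : size R = n.*2.+1 -> r != 0 ->
  mixed (sigma r) r t v R = 0.
Proof.
move=> szR r0.
have two a B : perm_eq B (sigma r :: r :: a :: R) -> dwbc1 B = straight true a r
    * \prod_(w <- R) straight true w r * r^-1 ^+ n.+1 * dwbc1 (a :: R).
  move=> pB; rewrite (@dwbc1_perm_sigma n.+1 (a :: R) _ r) ?big_cons //=.
  by rewrite szR doubleS.
rewrite /mixed (two t) // (two v (sigma r :: v :: r :: R)); last first.
  by apply/permP => c; rewrite /=; lia.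
rewrite /cross !exprS; move: (r^-1 ^+ n) (\prod_(_ <- _) _) => c1 c2.
by rewrite /straight /sigma; field.
Qed.

Lemma pluecker_sigma n r t v x R R' : size R' = n.*2.+1 -> x != 0 ->
  perm_eq R (x :: R') ->
  pluecker r t v (sigma x) R
  = \prod_(w <- R') straight true w x * x^-1 ^+ n.+2 * mixed x r t v R'.
Proof.
move=> szR' x0 pR.
have three a b : dwbc1 (a :: b :: R) = dwbc1 (x :: a :: b :: R').
  apply: dwbc1_perm; first by rewrite /= (perm_size pR) /= szR' /= !negbK
    odd_double.
  by apply/permP => c; have /permP/(_ c) := pR; rewrite /= => ->; lia.
have one a : dwbc1 (a :: sigma x :: R) = straight true a x
    * \prod_(w <- R') straight true w x * x^-1 ^+ n.+1 * dwbc1 (a :: R').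
  rewrite (@dwbc1_perm_sigma n.+1 (a :: R') _ x) ?big_cons //=.
    by rewrite szR' doubleS.
  by apply/permP => c; have /permP/(_ c) := pR; rewrite /= => ->; lia.
rewrite /mixed /pluecker !one !three /cross.
rewrite !exprS; move: (x^-1 ^+ n) (\prod_(_ <- _) _) => c1 c2.
by rewrite /straight /sigma; field.
Qed.

Lemma generic_subseq s s' : subseq s' s -> generic s -> generic s'.
Proof.
move=> ss' g; apply: (sub_generic _ _ g); last exact: mem_subseq.
by apply: subseq_uniq ss' _; case/and4P: g.
Qed.

Lemma sigma_points s z : generic (z ++ s) ->
  uniq (z ++ map (@sigma K) s).
Proof.
move=> g; have /and4P[] := g; rewrite cat_uniq => /and3P[uz _ us] _ _ _.
rewrite cat_uniq uz (map_inj_uniq (@sigma_inj K)) us andbT.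
apply/hasPn => _ /mapP[x xs ->]; apply/negP => zs.
have [] := @generic_sigma _ x (sigma x) g;
  rewrite ?mem_cat ?xs ?zs ?orbT ?eqxx //.
Qed.

Lemma polyfun_mixed n r t v R : size R = n.*2.+1 ->
  polyfun (n + 4) (fun q => mixed q r t v R).
Proof.
move=> szR; have term a b c : polyfun (n + 4)
    (fun q => (a - b) * cross c q * dwbc1 (q :: a :: b :: R) * dwbc1 (c :: R)).
  apply: (@eq_polyfun _ _ (fun q => ((a - b) * dwbc1 (c :: R))
     * (cross c q * dwbc1 (q :: a :: b :: R)))); first by move=> q; ring.
  apply: polyfunZ; rewrite addnC (_ : 4 + n = 2 + n.+2)%N; last by lia.
  apply: polyfunM; first exact: polyfun_cross_r.
  by apply: polyfun_dwbc1; rewrite /= szR doubleS.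
by apply: polyfunD; first apply: polyfunD.
Qed.

Lemma polyfun_pluecker n r t v R : size R = n.*2 ->
  polyfun (n + 2) (fun w => pluecker r t v w R).
Proof.
move=> szR; have term a b c : polyfun (n + 2)
    (fun w => (a - b) * (c - w) * dwbc1 (a :: b :: R) * dwbc1 (c :: w :: R)).
  apply: (@eq_polyfun _ _ (fun w => ((a - b) * dwbc1 (a :: b :: R))
     * ((-1 * w + c) * dwbc1 (w :: c :: R)))).
    by move=> w; rewrite (dwbc1_swap c w szR); ring.
  apply: polyfunZ; rewrite addnC (_ : 2 + n = 1 + n.+1)%N; last by lia.
  apply: polyfunM; first exact: polyfun_lin.
  by apply: polyfun_dwbc1; rewrite /= szR.
by apply: polyfunD; first apply: polyfunD.
Qed.

(** The Pluecker relation at n is a hypothesis here, so that the lemma can serve inside the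
    induction that proves this relation. There are 2n + 4 zeros [sigma x] against a degree of at
    most n + 3 in [q]. *)
Lemma mixed0 n q r t v R :
  (forall r t v w R, size R = n.*2 -> generic (r :: t :: v :: R) ->
     pluecker r t v w R = 0) ->
  size R = n.*2.+1 -> generic (r :: t :: v :: R) -> mixed q r t v R = 0.
Proof.
move=> pl0 szR gen; have neq0 x : x \in r :: t :: v :: R -> x != 0.
  by move=> xs; have [] := generic_sigma gen xs xs.
apply: (polyfun_ext (polyfun_mixed r t v szR) (polyfun0 _ _)
  (sigma_points (z := [::]) gen)).
  by rewrite /= size_map szR; lia.
move=> _ /mapP[x xs ->]; move: (xs); rewrite !inE =>
  /or4P[/eqP->|/eqP->|/eqP->|xR].
- by rewrite (@mixed_sigma3 n) ?neq0 ?mem_head.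
- by rewrite mixed_rot (@mixed_sigma3 n) ?neq0 // !inE eqxx ?orbT.
- by rewrite 2!mixed_rot (@mixed_sigma3 n) ?neq0 // !inE eqxx ?orbT.
have pR := perm_to_rem xR.
rewrite (mixed_sigma r t v (n := n) _ _ pR) ?neq0 ?size_rem ?szR //.
rewrite pl0 ?mulr0 ?size_rem ?szR //.
by apply: generic_subseq gen; rewrite /= !eqxx rem_subseq.
Qed.

(** Interpolation in [w]: the relation is trivial at [r], [t] and [v]. At [sigma x], with [x] in
    [R], it reduces to [mixed] for a list shorter by one, and so to the Pluecker relation for a list
    shorter by two. *)
Lemma pluecker0 n r t v w R : size R = n.*2 -> generic (r :: t :: v :: R) ->
  pluecker r t v w R = 0.
Proof.
elim: n r t v w R => [|n IH] r t v w R szR gen.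
  rewrite (size0nil szR) /pluecker /dwbc1 /= /dwbc /=; ring.
apply: (polyfun_ext (polyfun_pluecker r t v szR) (polyfun0 _ _)
    (sigma_points (z := [:: r; t; v]) gen)).
  by rewrite /= size_map szR; lia.
move=> y; rewrite !inE => /or4P[/eqP->|/eqP->|/eqP->|/mapP[x xR ->]].
- by rewrite /pluecker; cbv beta; rewrite (dwbc1_swap t r szR) (dwbc1_swap v r
  szR); ring.
- by rewrite /pluecker; cbv beta; rewrite (dwbc1_swap v t szR); ring.
- by rewrite /pluecker; cbv beta; rewrite (dwbc1_swap v r szR); ring.
have pR := perm_to_rem xR.
have [_ x0] : sigma x != x /\ x != 0.
  by apply/andP/andP; apply: (generic_sigma gen); rewrite !inE xR !orbT.
have szr : size (rem x R) = n.*2.+1 by rewrite size_rem // szR.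
rewrite (pluecker_sigma r t v szr x0 pR) (mixed0 _ IH szr) ?mulr0 //.
by apply: generic_subseq gen; rewrite /= !eqxx rem_subseq.
Qed.

(* In terms of the Izergin-Korepin determinant this is the Desnanot-Jacobi
   identity. *)
Lemma jacobi_generic n p q r t R : size R = n.+1.*2 ->
  generic (q :: r :: t :: R) ->
  (p - q) * (r - t) * dwbc1 (p :: q :: r :: t :: R) * dwbc1 R
  = cross p r * cross q t * dwbc1 (q :: r :: R) * dwbc1 (p :: t :: R)
    - cross p t * cross q r * dwbc1 (q :: t :: R) * dwbc1 (p :: r :: R).
Proof.
move=> szR gen; move: p.
have neq0 x : x \in q :: r :: t :: R -> x != 0.
  by move=> xs; have [] := generic_sigma gen xs xs.
have term a b : polyfun (n + 4) (fun p => cross p a * cross q b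
    * dwbc1 (q :: a :: R) * dwbc1 (p :: b :: R)).
  apply: (@eq_polyfun _ _ (fun p => (cross q b * dwbc1 (q :: a :: R))
     * (cross p a * dwbc1 (p :: b :: R)))); first by move=> w; ring.
  apply: polyfunZ; rewrite addnC (_ : 4 + n = 2 + n.+2)%N; last by lia.
  apply: polyfunM; first exact: polyfun_cross_l.
  by apply: polyfun_dwbc1; rewrite /= szR.
apply: (@polyfun_ext _ (n + 4) _ _ (q :: map (@sigma K) (r :: t :: R))).
- apply: (@eq_polyfun _ _ (fun p => ((r - t) * dwbc1 R)
     * ((1 * p - q) * dwbc1 (p :: q :: r :: t :: R)))); first by move=> w; ring.
  apply: polyfunZ; rewrite addnC (_ : 4 + n = 1 + n.+3)%N; last by lia.
  apply: polyfunM; first exact: polyfun_lin.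
  by apply: polyfun_dwbc1; rewrite /= szR !doubleS.
- apply: (@eq_polyfun _ _ (fun p => cross p r * cross q t * dwbc1 (q :: r ::
  R) * dwbc1 (p :: t :: R)
    + -1 * (cross p t * cross q r * dwbc1 (q :: t :: R) * dwbc1 (p :: r ::
      R)))).
    by move=> p; ring.
  by apply: polyfunD => //; apply: polyfunZ.
- by apply: (sigma_points (z := [:: q])).
- by rewrite /= size_map szR; lia.
have two (a : K) (A B : seq K) : a != 0 -> size A = n.+2.*2 ->
  perm_eq B (sigma a :: a :: A) ->
    dwbc1 B = \prod_(w <- A) straight true w a * a^-1 ^+ n.+2 * dwbc1 A.
  by move=> a0 szA pB; apply: dwbc1_perm_sigma.
(* At [p = q] both sides vanish. At [sigma r] and [sigma t] one product on the right vanishes and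
   the remaining terms reduce to the same value. At [sigma x], with [x] in [R], the identity becomes
   a relation [mixed]. *)
move=> p; rewrite !inE => /or3P[/eqP->|/eqP->|/orP[/eqP->|/mapP[x xR ->]]].
- by rewrite subrr !mul0r; ring.
- have r0 : r != 0 by rewrite neq0 // !inE eqxx orbT.
  rewrite (two r (q :: t :: R)) //=; [|by rewrite szR|]; last first.
    by apply/permP => c; rewrite /=; lia.
  rewrite (@dwbc1_perm_sigma n.+1 R [:: sigma r, r & R] r) //.
  rewrite !big_cons !exprS; move: (r^-1 ^+ n) (\prod_(_ <- _) _) => c1 c2.
  by rewrite /cross /straight /sigma; field.
- have t0 : t != 0 by rewrite neq0 // !inE eqxx !orbT.
  rewrite (two t (q :: r :: R)) //=; [|by rewrite szR|]; last first.
    by apply/permP => c; rewrite /=; lia.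
  rewrite (@dwbc1_perm_sigma n.+1 R [:: sigma t, t & R] t) //.
  rewrite !big_cons !exprS; move: (t^-1 ^+ n) (\prod_(_ <- _) _) => c1 c2.
  by rewrite /cross /straight /sigma; field.
have x0 : x != 0 by rewrite neq0 // !inE xR !orbT.
have pR := perm_to_rem xR; set R' := rem x R in pR.
have szR' : size R' = n.*2.+1 by rewrite size_rem // szR.
have one a : dwbc1 (sigma x :: a :: R) = straight true a x
    * \prod_(w <- R') straight true w x * x^-1 ^+ n.+1 * dwbc1 (a :: R').
  rewrite (@dwbc1_perm_sigma n.+1 (a :: R') _ x) ?big_cons //=.
    by rewrite szR' doubleS.
  by apply/permP => c; have /permP/(_ c) := pR; rewrite /= => ->; lia.
have three a b : dwbc1 (a :: b :: R) = dwbc1 (x :: a :: b :: R').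
  apply: dwbc1_perm; first by rewrite /= szR /= !negbK odd_double.
  by apply/permP => c; have /permP/(_ c) := pR; rewrite /= => ->; lia.
have zero : dwbc1 R = dwbc1 (x :: R').
  by apply: dwbc1_perm pR; rewrite szR odd_double.
rewrite (two x (q :: r :: t :: R')) //; last 2 first.
- by rewrite /= szR' !doubleS.
- by apply/permP => c; have /permP/(_ c) := pR; rewrite /= => ->; lia.
have := @mixed0 n q r t x R' (@pluecker0 n) szR'; rewrite /mixed.
rewrite !one !three zero.
rewrite big_cons !exprS !big_cons.
have -> : dwbc1 (q :: t :: x :: R') = dwbc1 (x :: q :: t :: R').
  by apply: dwbc1_perm; rewrite /= ?szR' /= ?negbK ?odd_double //;
    apply/permP => d; rewrite /=; lia.
have -> : dwbc1 (q :: x :: r :: R') = dwbc1 (x :: q :: r :: R').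
  by apply: dwbc1_perm; rewrite /= ?szR' /= ?negbK ?odd_double //;
    apply/permP => d; rewrite /=; lia.
move: (x^-1 ^+ n) (\prod_(_ <- _) _) => c1 c2 M.
apply/eqP; rewrite -subr_eq0; apply/eqP.
(* The difference of the two sides is this multiple of [mixed q r t x R']. *)
transitivity (- (straight true r x * straight true t x * c1 * c2 / x ^+ 3) * 0);
  last by rewrite mulr0.
rewrite -[in RHS]M; first by rewrite /cross /straight /sigma; field.
have gen' : generic (r :: t :: R) by apply: generic_subseq gen;
  rewrite subseq_cons.
apply: (sub_generic _ _ gen') => [|y].
  have := @perm_uniq _ (r :: t :: R) (r :: t :: x :: R');
    rewrite 2!perm_cons => /(_ pR) <-.
  by case/and4P: gen'.
by have := perm_mem pR y; rewrite !inE => <-.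
Qed.

End Pluecker.

Lemma rmorph_dwbc1 (R R' : comNzRingType) (phi : {rmorphism R -> R'}) s :
  phi (dwbc1 s) = dwbc1 (map phi s).
Proof. by rewrite rmorph_dwbc map_take map_drop /dwbc1 size_map. Qed.

(** Genericity has to go, because the application sets [t] and all of [R] to 1. *)
Lemma jacobi (K : fieldType) n (p q r t : K) (R : seq K) : size R = n.+1.*2 ->
  (p - q) * (r - t) * dwbc1 (p :: q :: r :: t :: R) * dwbc1 R
  = cross p r * cross q t * dwbc1 (q :: r :: R) * dwbc1 (p :: t :: R)
    - cross p t * cross q r * dwbc1 (q :: t :: R) * dwbc1 (p :: r :: R).
Proof.
move=> szR.
pose f (F : comNzRingType) (s : seq F) := let R := drop 4 s in
  (s`_0 - s`_1) * (s`_2 - s`_3) * dwbc1 (s`_0 :: s`_1 :: s`_2 :: s`_3 :: R) *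
    dwbc1 R.
pose g (F : comNzRingType) (s : seq F) := let R := drop 4 s in
  cross s`_0 s`_2 * cross s`_1 s`_3 * dwbc1 (s`_1 :: s`_2 :: R) * dwbc1 (s`_0
    :: s`_3 :: R)
  - cross s`_0 s`_3 * cross s`_1 s`_2 * dwbc1 (s`_1 :: s`_3 :: R) * dwbc1
    (s`_0 :: s`_2 :: R).
have fN : natural f.
  by move=> F F' phi s; rewrite /f !rmorphM !rmorphB !rmorph_dwbc1 /=
    !map_drop !rmorph_nth.
have gN : natural g.
  by move=> F F' phi s; rewrite /g /cross rmorphB !rmorphM !rmorph_dwbc1
    !rmorph_straight /= !map_drop !rmorph_nth.
have := @generic_ext f g (4 + n.+1.*2) fN gN _ K (p :: q :: r :: t :: R).
rewrite /f /g /= drop0 szR; apply=> //.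
move=> {szR} {}K [|{}p [|{}q [|{}r [|{}t {}R]]]] //= [szR] gen; rewrite drop0.
by apply: (jacobi_generic p szR); apply: generic_subseq gen;
  rewrite subseq_cons.
Qed.

(** * Refined enumeration *)

Lemma state0 s x : state s x 0 = s.
Proof. by rewrite /state take0 addbF. Qed.

Lemma run_no_neg s x : run s x -> all (fun a => a != -1) x ->
  if s then x = nseq (size x) 0
  else exists a b, x = nseq a 0 ++ 1 :: nseq b 0.
Proof.
elim: x s => [|a x IH] s /=; first by case: s.
case: eqP => [-> /IH{}IH /IH|_ /andP[/eqP->]].
  by case: s {IH} => [<- //|[b [c ->]]]; exists b.+1, c.
case: s => //= /IH{}IH /IH ->.
by exists 0%N, (size x).
Qed.

Lemma state_line a b j :
  state false (nseq a 0 ++ 1 :: nseq b 0) j = (a < j)%N.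
Proof.
have nseq0 i s : state s (nseq b 0) i = s.
  elim: b i s => [|b' IH] [|i] s; rewrite ?state0 //;
    first by rewrite /state addbF.
  by rewrite -[nseq b'.+1 0]/(0 :: nseq b' 0) state_cons addbF IH.
elim: a j => [|a IH] [|j]; rewrite ?state0 //;
  first by rewrite state_cons nseq0.
by rewrite -[nseq a.+1 0 ++ _]/(0 :: nseq a 0 ++ _) state_cons addbF IH.
Qed.

Lemma state_run s x : run s x -> state s x (size x).
Proof.
rewrite /state take_size; elim: x s => [|a x IH] s //=; first by rewrite addbF.
case: eqP => [_ /IH//|_ /andP[_ /IH]]; by rewrite add1n oddS addbN addNb.
Qed.

Lemma line_spec n (x : 'I_n -> int) :
  run false [seq x j | j <- enum 'I_n] -> (forall j, x j != -1) ->
  exists k : 'I_n, (forall j, x j = (j == k)%:R)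
    /\ forall j : nat, state false [seq x j | j <- enum 'I_n] j = (k < j)%N.
Proof.
move=> r xN; have [|a [b xE]] := run_no_neg r.
  by apply/allP => _ /mapP[j _ ->].
have ab : (a + b.+1)%N = n.
  by have := congr1 size xE; rewrite size_map size_enum_ord size_cat /=
    !size_nseq.
have an : (a < n)%N by rewrite -ab addnS ltnS leq_addr.
exists (Ordinal an); split=> [j|j]; last by rewrite xE state_line.
rewrite -[LHS](nth_map_enum 0 x j) xE nth_cat size_nseq nth_nseq -val_eqE /=.
case: ltngtP => [//|aj|->]; last by rewrite subnn.
by rewrite -[(j - a)%N]prednK ?subn_gt0 //= nth_nseq if_same.
Qed.

Lemma card_ord_lt n k : (k <= n)%N -> #|[set j : 'I_n | (j < k)%N]| = k.
Proof.
move=> kn; rewrite -sum1_card; under eq_bigl do rewrite inE.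
by rewrite (big_ord_narrow kn) sum_nat_const card_ord muln1.
Qed.

Lemma card_ord_gt n (k : 'I_n) : #|[set j : 'I_n | (k < j)%N]| = (n.-1 - k)%N.
Proof.
have := cardsC [set j : 'I_n | (j < k.+1)%N].
rewrite card_ord_lt ?ltn_ord // card_ord.
have -> : ~: [set j : 'I_n | (j < k.+1)%N] = [set j : 'I_n | (k < j)%N].
  by apply/setP => j; rewrite !inE ltnS -ltnNge.
by lia.
Qed.

(** * The boundary lines of an ASM *)

Section Boundary.
Variables (m : nat) (A : 'M[asm_entry]_m.+2).
Hypothesis ASM_A : A \in ASM m.+2.
Let B := asm_int A.

(** The column sums to 1, and its last entry changes the partial sum exactly when it is nonzero. *)
Lemma v_state_last j : v_state B ord_max j = (B ord_max j == 0).
Proof.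
have /state_run := asm_colP j ASM_A; rewrite -/B size_map size_enum_ord.
rewrite /v_state; set x := [seq _ | _ <- _].
have sx : size x = m.+2 by rewrite size_map size_enum_ord.
have xm : nth 0 x m.+1 = B ord_max j by rewrite (nth_map_enum 0 _ ord_max).
rewrite /state (take_nth 0) ?sx // -cats1 count_cat xm /= addn0 oddD.
by case: (B ord_max j == 0); case: (odd _).
Qed.

(** A -1 in the top row would need the partial sum 1 above it, so the row has a single nonzero
    entry. *)
Lemma top_spec : exists k : 'I_m.+2, [/\ rho_T B = k,
  forall j, B ord0 j = (j == k)%:R & forall j, h_state B ord0 j = (k < j)%N].
Proof.
have [j|k [kE hE]] := line_spec (asm_rowP ord0 ASM_A).
  apply/eqP => jN; have := @asm_v_state _ _ ord0 j ASM_A.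
  by rewrite jN /v_state state0 => /(_ isT).
exists k; split=> [|j|j]; [|exact: kE|exact: hE];
  rewrite -[RHS](card_ord_lt (ltnW (ltn_ord k))).
apply: eq_card => j; rewrite !inE; apply/existsP/idP.
  case=> i /existsP[l /and4P[/eqP i0 _ /eqP il jl]].
  have {i0}i0 : i = ord0 by apply: val_inj.
  by move: il; rewrite {}i0 -/B kE; case: eqP => // <-.
move=> jk; exists ord0; apply/existsP; exists k.
by rewrite /= jk -/B !kE eqxx -val_eqE (ltn_eqF jk).
Qed.

Lemma bottom_spec : exists k : 'I_m.+2, [/\ rho_B B = (m.+1 - k)%N,
  forall j, B ord_max j = (j == k)%:R & forall j, h_state B ord_max j =
    (k < j)%N].
Proof.
have [j|k [kE hE]] := line_spec (asm_rowP ord_max ASM_A).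
  apply/eqP => jN; have := @asm_v_state _ _ ord_max j ASM_A.
  by rewrite -/B v_state_last /B jN => /(_ isT).
exists k; split=> [|j|j]; [|exact: kE|exact: hE]; rewrite -[RHS](card_ord_gt k).
apply: eq_card => j; rewrite !inE; apply/existsP/idP.
  case=> i /existsP[l /and4P[/eqP[i0] _ /eqP il jl]].
  have {i0}i0 : i = ord_max by apply: val_inj.
  by move: il; rewrite {}i0 -/B kE; case: eqP => // <-.
move=> jk; exists ord_max; apply/existsP; exists k.
by rewrite /= jk -/B !kE !eqxx -val_eqE (gtn_eqF jk).
Qed.

Lemma left_spec : exists k : 'I_m.+2, [/\ rho_L B = k,
  forall i, B i ord0 = (i == k)%:R & forall i, v_state B i ord0 = (k < i)%N].
Proof.
have [j|k [kE hE]] := line_spec (asm_colP ord0 ASM_A).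
  apply/eqP => jN; have := @asm_h_state _ _ j ord0 ASM_A.
  by rewrite jN /h_state state0 => /(_ isT).
exists k; split=> [|j|j]; [|exact: kE|exact: hE];
  rewrite -[RHS](card_ord_lt (ltnW (ltn_ord k))).
apply: eq_card => j; rewrite !inE; apply/existsP/idP.
  case=> i /existsP[l /and4P[/eqP i0 _ /eqP il jl]].
  have {i0}i0 : i = ord0 by apply: val_inj.
  by move: il; rewrite {}i0 -/B kE; case: eqP => // <-.
move=> jk; exists ord0; apply/existsP; exists k.
by rewrite /= jk -/B !kE eqxx -val_eqE (ltn_eqF jk).
Qed.

(** Both sides say that the top left corner entry is 1. *)
Lemma rho_TL : (rho_T B == 0%N) = (rho_L B == 0%N).
Proof.
have [k [-> kE _]] := top_spec; have [l [-> lE _]] := left_spec.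
have := kE ord0; rewrite lE -!val_eqE /= ![0%N == _]eq_sym.
by case: (_ == _) (_ == _) => [] [].
Qed.

Lemma rho_BL : (rho_B B == m.+1) = (rho_L B == m.+1).
Proof.
have [k [-> kE _]] := bottom_spec; have [l [-> lE _]] := left_spec.
have := kE ord0; rewrite lE -!val_eqE /=.
have -> : (m.+1 - k == m.+1)%N = (0%N == k) by have := ltn_ord k; lia.
rewrite eq_sym; by case: (_ == _) (_ == _) => [] [].
Qed.

Lemma rho_L_le : (rho_L B <= m.+1)%N.
Proof. by have [k [-> _ _]] := left_spec; rewrite -ltnS. Qed.
End Boundary.

Lemma sum_ltn N c : (\sum_(j < N) (j < c) = minn c N)%N.
Proof.
by elim: N => [|N IH]; rewrite ?big_ord0 ?minn0 // big_ord_recr /= IH; lia.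
Qed.

Lemma sum_leq N c : (\sum_(j < N) (c <= j) = N - c)%N.
Proof. by elim: N => [|N IH]; rewrite ?big_ord0 // big_ord_recr /= IH; lia. Qed.

(** * Evaluation with all but three boundary parameters equal to 1 *)

Section Evaluation.
Variables (K : fieldType) (m : nat).
Implicit Types (z : K).

Lemma vertex_u1 z (a : int) (l s : bool) :
  vertex true z 1 a l s = if a == 0 then (if l == s then z else 1)
                          else if l then turn z else 1.
Proof.
rewrite /vertex /straight /turn; case: (a == 0); case: l; case: s => /=;
  by ring.
Qed.

Lemma vertex_1v z (a : int) (l s : bool) :
  vertex true 1 z a l s = if a == 0 then (if l == s then 1 else z)
                          else if l then turn z else 1.
Proof.
rewrite /vertex /straight /turn; case: (a == 0); case: l; case: s => /=;
  by ring.
Qed.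

Lemma vertex_11 (a : int) (l s : bool) : vertex true (1 : K) 1 a l s = 1.
Proof. by rewrite vertex_u1 /turn; case: ifP; case: ifP => //= _ _; ring. Qed.

Let vs z3 : seq K := z3 :: nseq m.+1 1.

Let vsS z3 (j : 'I_m.+1) : (vs z3)`_(lift ord0 j) = 1.
Proof. by rewrite -[LHS]/((nseq m.+1 1)`_j) nth_nseq ltn_ord. Qed.

(** The zeros before the 1 weigh [z1] each, except for the corner zero, which meets the parameter
    [z3]; hence the exponent [k.-1]. The zeros after the 1 weigh 1. *)
Lemma top_weight z1 z3 (k : 'I_m.+2) :
  \prod_(j < m.+2) vertex true z1 (vs z3)`_j (j == k)%:R (k < j)%N false
  = if k == 0%N :> nat then 1 else straight false z1 z3 * z1 ^+ k.-1.
Proof.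
rewrite big_ord_recl.
under eq_bigr => j _.
  rewrite vsS vertex_u1 (_ : (if _ then _ else _) = z1 ^+ (j < k.-1)%N).
    over.
  rewrite -val_eqE /= /bump /=; case: (ltngtP k j.+1) => [kj|jk|kj] /=.
  - by rewrite (_ : (j < k.-1)%N = false) //; lia.
  - by rewrite (_ : (j < k.-1)%N = true) //; lia.
  - by rewrite (_ : (j < k.-1)%N = false) //; lia.
rewrite -expr_sum sum_ltn (minn_idPl _); last by have := ltn_ord k; lia.
rewrite -val_eqE /= ltn0 eq_sym /vertex /=.
by case: (nat_of_ord k) => [|k'] //=; rewrite expr0 mulr1.
Qed.

Lemma bottom_weight z2 z3 (k : 'I_m.+2) :
  \prod_(j < m.+2) vertex true z2 (vs z3)`_j (j == k)%:R (k < j)%N (j != k)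
  = (if k == 0%N :> nat then 1 else straight true z2 z3) * z2 ^+ (m.+1 - k).
Proof.
rewrite big_ord_recl.
under eq_bigr => j _.
  rewrite vsS vertex_u1 (_ : (if _ then _ else _) = z2 ^+ (k <= j)%N).
    over.
  rewrite -val_eqE /= /bump /=; case: (ltngtP k j.+1) => [kj|jk|kj] /=.
  - by rewrite (_ : (k <= j)%N = true) //; lia.
  - by rewrite (_ : (k <= j)%N = false) //; lia.
  - by rewrite (_ : (k <= j)%N = false) //; lia.
rewrite -expr_sum sum_leq -val_eqE /= ltn0 eq_sym /vertex /=.
by case: (nat_of_ord k).
Qed.

Lemma dwbc_weight z1 z2 z3 (A : 'M[asm_entry]_m.+2) : A \in ASM m.+2 ->
  let B := asm_int A in
  \prod_(i < m.+2) \prod_(j < m.+2)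
     vertex true (z1 :: rcons (nseq m 1) z2)`_i (vs z3)`_j (B i j)
       (h_state B i j) (v_state B i j)
  = (if rho_T B == 0%N then 1 else straight false z1 z3 * z1 ^+ (rho_T B).-1)
    * ((if rho_B B == m.+1 then 1 else straight true z2 z3) * z2 ^+ rho_B B)
    * z3 ^+ (m - rho_L B).
Proof.
move=> ASM_A B.
have [k [-> kE kh]] := top_spec ASM_A.
have [l [-> lE lh]] := bottom_spec ASM_A.
have [i0 [-> iE iv]] := left_spec ASM_A.
rewrite big_ord_recl [X in _ * X = _]big_ord_recr; set W := RHS.
rewrite /= mulrA mulrAC {}/W; congr (_ * _ * _).
- rewrite -top_weight; apply: eq_bigr => j _.
  by rewrite [B _ _]kE kh /v_state state0.
- have -> : (m.+1 - l == m.+1)%N = (l == 0%N :> nat) by have := ltn_ord l; lia.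
  rewrite -bottom_weight; have -> : lift ord0 ord_max = ord_max :> 'I_m.+2.
    by apply: val_inj.
  apply: eq_bigr => j _.
  rewrite [B _ _]lE lh v_state_last // -/B [B _ _]lE.
  rewrite [nth _ _ (_ + _)](_ : _ = z2); last first.
    by rewrite add0n nth_rcons size_nseq ltnn eqxx.
  by case: (j == l).
(* In the inner rows exactly the zeros below the 1 of the left column weigh [z3]. The truncated
   difference is 0 when this 1 lies in the last row. *)
rewrite -[(m - i0)%N]sum_leq expr_sum; apply: eq_bigr => i _.
rewrite [nth _ _ (_ + _)](_ : _ = 1); last first.
  by rewrite add0n nth_rcons size_nseq ltn_ord nth_nseq ltn_ord.
rewrite big_ord_recl big1 => [|j _]; last by rewrite vsS vertex_11.
rewrite mulr1 vertex_1v /h_state state0 -/(v_state _ _ _) iv [B _ _]iE /=.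
rewrite -val_eqE /= /bump /=; case: (ltngtP i0 i.+1) => [ki|ik|ki] /=.
- by rewrite (_ : (i0 <= i)%N = true) //; lia.
- by rewrite (_ : (i0 <= i)%N = false) //; lia.
- by rewrite (_ : (i0 <= i)%N = false) //; lia.
Qed.

Lemma dwbc_eval z1 z2 z3 :
  dwbc true (z1 :: rcons (nseq m 1) z2) (z3 :: nseq m.+1 1)
  = \sum_(A in ASM m.+2) let B := asm_int A in
    (if rho_T B == 0%N then 1 else straight false z1 z3 * z1 ^+ (rho_T B).-1)
    * ((if rho_B B == m.+1 then 1 else straight true z2 z3) * z2 ^+ rho_B B)
    * z3 ^+ (m - rho_L B).
Proof.
rewrite (@dwbc_sum _ m.+2) /= ?size_rcons ?size_nseq //.
by apply: eq_bigr => A; apply: dwbc_weight.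
Qed.

Lemma dwbc_Z_opp z1 z2 :
  dwbc true (z1 :: rcons (nseq m 1) z2) (nseq m.+2 1) = Z_opp m.+2 z1 z2.
Proof.
rewrite (dwbc_eval z1 z2 1); apply: eq_bigr => A ASM_A /=.
rewrite expr1n mulr1 /straight; congr (_ * _).
  case: (rho_T _) => [|k] //=; rewrite exprS; ring.
by rewrite (_ : z2 * 1 - z2 + 1 = 1) ?if_same ?mul1r //; ring.
Qed.

Lemma Z_Z_opp n z : Z n z = Z_opp n z 1.
Proof. by apply: eq_bigr => A _; rewrite expr1n mulr1. Qed.

Lemma dwbc_Z z : dwbc true (z :: nseq m.+1 1) (nseq m.+2 1) = Z m.+2 z.
Proof.
rewrite Z_Z_opp -dwbc_Z_opp; congr (dwbc _ (_ :: _) _).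
by elim: m => //= k ->.
Qed.
End Evaluation.

Lemma dwbc_card (K : fieldType) n : dwbc true (nseq n 1) (nseq n 1) =
  #|ASM n|%:R :> K.
Proof.
rewrite (dwbc_sum _ (size_nseq _ _) (size_nseq _ _)) -sum1_card natr_sum.
apply: eq_bigr => A _; rewrite big1 // => i _; rewrite big1 // => j _.
by rewrite !nth_nseq !ltn_ord vertex_11.
Qed.

(** * Matrices with a 1 in a left corner *)

Section Corners.
Variables (K : fieldType) (m : nat).
Implicit Types (z : K).

(** Two evaluations at z1 = 0 and z3 = 1, where the corner weight vanishes: [dwbc_eval] keeps the
    ASMs with a 1 in this corner, and [dwbc_corner] removes its row and column. *)
Lemma top_left_corner z :
  \sum_(A in ASM m.+3 | rho_L (asm_int A) == 0%N) z ^+ rho_B (asm_int A) =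
    Z m.+2 z.
Proof.
have : dwbc true (0 :: rcons (nseq m.+1 1) z) (1 :: nseq m.+2 1) = Z m.+2 z.
  rewrite dwbc_corner; last by rewrite /straight /=; ring.
  rewrite big1_seq => [|w /andP[_ /nseqP[-> _]]]; last by rewrite /straight;
    ring.
  rewrite big1_seq => [|w _]; last by rewrite /straight; ring.
  rewrite !mul1r -dwbc_Z; apply: dwbc_perm_rows.
  by rewrite perm_rcons.
rewrite dwbc_eval => <-; rewrite [LHS]big_mkcondr; apply: eq_bigr => A ASM_A.
have -> : straight false 0 1 = 0 :> K by rewrite /straight; ring.
have -> : straight true z 1 = 1 by rewrite /straight; ring.
rewrite /= expr1n if_same rho_TL // mul0r; move: (z ^+ _) => c.
by case: ifP => _; ring.
Qed.

(** The first column parameter 0 makes the bottom left weight vanish. The factor [z] counts the zero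
    that the left column adds to the top row. *)
Lemma bottom_left_corner z :
  \sum_(A in ASM m.+3 | rho_L (asm_int A) == m.+2) z ^+ rho_T (asm_int A)
  = z * Z m.+2 z.
Proof.
have : dwbc true (z :: rcons (nseq m.+1 1) 1) (0 :: nseq m.+2 1) = Z m.+2 z.
  (* [dwbc_corner] treats the top left corner, so the full symmetry moves 0 to the first row and a 1
     to the first column. *)
  rewrite (@dwbc_perm _ _ (0 :: nseq m.+2 1) _ (1 :: z :: nseq m.+1 1)).
  - rewrite dwbc_corner; last by rewrite /straight /=; ring.
    rewrite big1_seq => [|w _]; last by rewrite /straight; ring.
    rewrite big1_seq => [|w /andP[_ /nseqP[-> _]]]; last by rewrite /straight;
      ring.
    rewrite !mul1r -dwbc_Z; apply: dwbc_perm; rewrite ?size_nseq //.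
    - by rewrite /= !size_nseq.
    - by rewrite /= !size_nseq.
    by rewrite perm_catC.
  - by rewrite /= size_rcons !size_nseq.
  - by rewrite /= !size_nseq.
  by rewrite perm_catC perm_cat2l -rcons_cons perm_rcons.
rewrite dwbc_eval => <-; rewrite [LHS]big_mkcondr mulr_sumr;
  apply: eq_bigr => A ASM_A.
have -> : straight true 1 0 = 0 :> K by rewrite /straight; ring.
have -> : straight false z 0 = 1 by rewrite /straight; ring.
rewrite /= expr1n rho_BL // rho_TL // !mul1r mulr1.
case: eqP => [L|_]; last by rewrite mulr0 mul0r mulr0.
have : rho_T (asm_int A) != 0%N by rewrite rho_TL // L.
rewrite L (_ : m.+1 - m.+2 = 0)%N; last by lia.
by case: (rho_T _) => // k _; rewrite /= exprS expr0; ring.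
Qed.

(* The left corner weights mix z3 with z1 or z2, so A is weighted according to
   whether its left column has its 1 at the top, at the bottom or in between. *)
Lemma dwbc_Z_tri z1 z2 z3 : z3 != 0 ->
  z1 * z3 * dwbc true (z1 :: rcons (nseq m.+1 1) z2) (z3 :: nseq m.+2 1)
  = straight false z1 z3 * straight true z2 z3 * z3 ^+ m.+2
      * Z_tri m.+3 z1 z2 (1 / z3)
    - (z1 - 1) * (z3 - 1) * straight true z2 z3 * z3 ^+ m.+2 * Z m.+2 z2
    - (z2 - 1) * (z3 - 1) * straight false z1 z3 * z2 ^+ m.+2 * (z1 * Z m.+2
      z1).
Proof.
move=> z30; rewrite dwbc_eval -top_left_corner -bottom_left_corner.
rewrite !mulr_sumr [X in _ - X - _]big_mkcondr [X in _ - _ - X]big_mkcondr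
  -!sumrB.
apply: eq_bigr => A ASM_A /=; rewrite rho_TL // rho_BL //.
have TL := rho_TL ASM_A; have BL := rho_BL ASM_A; have Lm := rho_L_le ASM_A.
rewrite mul1r exprVn.
have [L0|L0] := eqVneq (rho_L (asm_int A)) 0%N.
  have T0 : rho_T (asm_int A) = 0%N by apply/eqP; rewrite TL L0.
  rewrite L0 T0 /= subn0 expr0 invr1 !exprS /straight.
  by move: (z2 ^+ _) (z3 ^+ _) => c d; ring.
have : rho_T (asm_int A) != 0%N by rewrite TL.
case: (rho_T _) {TL} => // k _ /=; rewrite !(exprS z1) -/(straight _ _ _).
have [Lb|Lb] := eqVneq (rho_L (asm_int A)) m.+2.
  have -> : rho_B (asm_int A) = m.+2 by apply/eqP; rewrite BL Lb.
  rewrite Lb (_ : m.+1 - m.+2 = 0)%N ?expr0; last by lia.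
  have z3m : z3 ^+ m.+2 != 0 by rewrite expf_neq0.
  move: (z3 ^+ m.+2) (z2 ^+ m.+2) (z1 ^+ _) z3m => c d e c0.
  by rewrite /straight; field.
(* Here [rho_L] is at most [m.+1], so the subtraction is exact. *)
have -> : z3 ^+ m.+2 = z3 * z3 ^+ (m.+1 - rho_L (asm_int A)) * z3 ^+ rho_L
  (asm_int A).
  by rewrite -exprS -exprD; congr (_ ^+ _); lia.
have : z3 ^+ rho_L (asm_int A) != 0 by rewrite expf_neq0.
move: (z3 ^+ rho_L _) (z3 ^+ (_ - _)) (z2 ^+ _) (z1 ^+ _) => c d e f c0.
by rewrite /straight; field.
Qed.
End Corners.

(** The identity matrix is an ASM. The theorem divides by this cardinal. *)
Lemma ASM_gt0 n : (0 < #|ASM n|)%N.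
Proof.
pose e (b : bool) : asm_entry := if b then SeqSub (isT : 1 \in [:: 0; 1;
  -1 : int])
  else SeqSub (isT : 0 \in [:: 0; 1; -1 : int]).
have eE b : val (e b) = b%:R by case: b.
have line (i : 'I_n) : asm_line [seq (i == j)%:R | j <- enum 'I_n].
  rewrite /asm_line filter_map (_ : [seq j <- _ | _] =
    [:: i]) /= ?eqxx ?big_seq1 //.
  rewrite -[RHS](filter_pred1_uniq (enum_uniq 'I_n) (mem_enum _ _)).
  by apply: eq_filter => j /=; rewrite [RHS]eq_sym; case: (i == j).
apply/card_gt0P; exists (\matrix_(i, j) e (i == j)); rewrite inE.
apply/andP; split; apply/forallP => i.
  by rewrite (eq_map (_ : _ =1 fun j => (i == j)%:R)) // => j; rewrite !mxE eE.
by rewrite (eq_map (_ : _ =1 fun j => (i == j)%:R)) // => j;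
  rewrite !mxE eE eq_sym.
Qed.

Lemma perm_nseq (T : eqType) (o : T) a s b :
  perm_eq (s ++ nseq (a + b) o) (nseq a o ++ s ++ nseq b o).
Proof. by rewrite perm_sym perm_catCA nseqD. Qed.

Lemma dwbc1E (K : fieldType) (s us vs : seq K) : size us = size vs ->
  perm_eq s (us ++ vs) -> dwbc1 s = dwbc true us vs.
Proof.
move=> szuv ps; rewrite -(dwbc1_cat szuv); apply: dwbc1_perm => //.
by rewrite (perm_size ps) size_cat szuv addnn odd_double.
Qed.

Lemma dwbc1_Z_opp (K : fieldType) k (x y : K) :
  dwbc1 (x :: y :: nseq k.+1.*2 1) = Z_opp k.+2 x y.
Proof.
rewrite -dwbc_Z_opp; apply: dwbc1E; first by rewrite /= size_rcons !size_nseq.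
rewrite [_ ++ _]/= perm_cons cat_rcons (_ : k.+1.*2 = k + k.+2)%N; last by lia.
exact: (perm_nseq 1 k [:: y] k.+2).
Qed.

Lemma dwbc1_tri (K : fieldType) k (x y z : K) :
  dwbc1 (x :: y :: z :: 1 :: nseq k.+1.*2 1)
  = dwbc true (x :: rcons (nseq k.+1 1) y) (z :: nseq k.+2 1).
Proof.
apply: dwbc1E; first by rewrite /= size_rcons !size_nseq.
rewrite [_ ++ _]/= perm_cons cat_rcons.
rewrite -[1 :: nseq _ _]/(nseq k.+1.*2.+1 1) (_ : k.+1.*2.+1 = k.+1 + k.+2)%N;
  last by lia.
exact: (perm_nseq 1 k.+1 [:: y; z] k.+2).
Qed.

(** The identity [jacobi] at z1, z2, z3, 1 with [R] a list of 1s expresses the partition function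
    [D] through smaller enumerations, and [dwbc_Z_tri] relates [D] to [Z_tri]. *)
Lemma triply_refined (K : fieldType) k (z1 z2 z3 : K) :
  z1 != z2 -> z3 != 0 -> z3 != 1 -> #|ASM k.+1|%:R != 0 :> K ->
  (z1 * z3 - z3 + 1) * (z2 * z3 - z2 + 1) * z3 ^+ k.+2
    * Z_tri k.+3 z1 z2 (1 / z3)
  = z1 * z3 / (#|ASM k.+1|%:R * (z1 - z2) * (z3 - 1))
    * ((z1 * z3 - z1 + 1) * (z1 * z3 - z3 + 1) * z2
         * Z k.+2 z1 * Z_opp k.+2 z2 z3
       - (z2 * z3 - z2 + 1) * (z2 * z3 - z3 + 1) * z1
         * Z k.+2 z2 * Z_opp k.+2 z1 z3)
    + (z2 - 1) * (z3 - 1) * (z1 * z3 - z3 + 1) * z1 * z2 ^+ k.+2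
      * Z k.+2 z1
    + (z1 - 1) * (z3 - 1) * (z2 * z3 - z2 + 1) * z3 ^+ k.+2
      * Z k.+2 z2.
Proof.
move=> z12 z30 z31 A0.
have J := @jacobi K k z1 z2 z3 1 (nseq k.+1.*2 1) (size_nseq _ _).
rewrite dwbc1_tri !dwbc1_Z_opp -!Z_Z_opp in J.
have cardE : dwbc1 (nseq k.+1.*2 1) = #|ASM k.+1|%:R :> K.
  by rewrite -dwbc_card; apply: dwbc1E => //; rewrite -nseqD addnn.
have cross1 z : cross z 1 = z by rewrite /cross /straight; ring.
rewrite cardE !cross1 in J.
have E := dwbc_Z_tri k z1 z2 z30.
have z12' : z1 - z2 != 0 by rewrite subr_eq0.
have z31' : z3 - 1 != 0 by rewrite subr_eq0.
set D := dwbc _ _ _ in J E; rewrite /cross /straight in J E.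
have {J} -> : (z1 * z3 - z1 + 1) * (z1 * z3 - z3 + 1) * z2
      * Z k.+2 z1 * Z_opp k.+2 z2 z3
    - (z2 * z3 - z2 + 1) * (z2 * z3 - z3 + 1) * z1
      * Z k.+2 z2 * Z_opp k.+2 z1 z3
  = (z1 - z2) * (z3 - 1) * D * #|ASM k.+1|%:R by rewrite J; ring.
have -> : z1 * z3 / (#|ASM k.+1|%:R * (z1 - z2) * (z3 - 1))
  * ((z1 - z2) * (z3 - 1) * D * #|ASM k.+1|%:R) = z1 * z3 * D.
  by field; rewrite z31' z12' A0.
by rewrite E; ring.
Qed.

Theorem corollary11 (n : nat) (hn : (3 <= n)%N) :
  let z1 : ratfun3 := indet 0 in
  let z2 : ratfun3 := indet 1 in
  let z3 : ratfun3 := indet 2 in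
  (z1 * z3 - z3 + 1) * (z2 * z3 - z2 + 1) * z3 ^+ (n - 1)
    * Z_tri n z1 z2 (1 / z3)
  = z1 * z3 / (#|ASM (n - 2)|%:R * (z1 - z2) * (z3 - 1))
    * ((z1 * z3 - z1 + 1) * (z1 * z3 - z3 + 1) * z2
         * Z (n - 1) z1 * Z_opp (n - 1) z2 z3
       - (z2 * z3 - z2 + 1) * (z2 * z3 - z3 + 1) * z1
         * Z (n - 1) z2 * Z_opp (n - 1) z1 z3)
    + (z2 - 1) * (z3 - 1) * (z1 * z3 - z3 + 1) * z1 * z2 ^+ (n - 1)
      * Z (n - 1) z1
    + (z1 - 1) * (z3 - 1) * (z2 * z3 - z2 + 1) * z3 ^+ (n - 1)
      * Z (n - 1) z2.
Proof.
move=> z1 z2 z3; case: n hn => [|[|[|k]]] // _; rewrite !subSS !subn0.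
(* Genericity of the indeterminates makes z3, z3 - 1 and z1 - z2 nonzero. *)
have gen := generic_indets rat 3; set s := map _ _ in gen.
have z_s i : indet i \in s by apply: map_f; rewrite mem_enum.
have [z30 z31 _] : [/\ z3 != 0, z3 != 1 & straight true z3 z3 != 0].
  exact: generic_neq gen (z_s 2) (z_s 2).
have z12 : z1 != z2.
  have /injectiveP indet_inj : injectiveb indet by case/and4P: gen.
  by apply/eqP => /indet_inj.
have A0 : #|ASM k.+1|%:R != 0 :> ratfun3.
  rewrite -(rmorph_nat (tofrac (R:={mpoly rat[3]}))) tofrac_eq0.
  rewrite -(rmorph_nat (@mpolyC 3 rat)) mpolyC_eq0 Num.Theory.pnatr_eq0.
  by rewrite -lt0n ASM_gt0.
clearbody z1 z2 z3.
exact: (@triply_refined ratfun3 k z1 z2 z3 z12 z30 z31 A0).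
Qed.
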